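(* For each integer $m\ge 2$ there is a neighborhood $U_m$ of $0$ in $\mathbb{R}^{m-1}$ such that the following statements hold. (i) The generating function $M_m(x,h)$ is defined (i.e. its defining series converges absolutely) whenever $x\in\mathbb{R}^m$, $|x|_m\le 1$ and $h\in U_m$. (ii) For each $k=(k_2,\ldots,k_m)\in\mathbb{N}_0^{m-1}$ and each $x\in\mathbb{R}^m$ with $|x|_m\le 1$, $$mon_k(x)=\frac{1}{k!}\,\partial^{k}M_m(x,h)\Big|_{h=0},$$ where $k!=(k_2!)\cdots(k_m!)$ and $\partial^k=\partial_{h_2}^{k_2}\cdots\partial_{h_m}^{k_m}$. (iii) If $m\ge 3$, $|x|_m\le 1$ and $h\in U_m$, then $$M_m(x,h)=(1+x\,h_m e_m)\,d_m^{\,-\frac m2}\,M_{m-1}(\underline{x},\underline{h}/d_m),$$ where $d_m=1-2x_mh_m+h_m^2|x|_m^2$, $\underline{x}=(x_1,\ldots,x_{m-1})$, $\underline{h}/d_m=(h_2/d_m,\ldots,h_{m-1}/d_m)$, and in the factor $1+xh_me_m$ the vector $x$ is regarded as the Clifford algebra element $x_1e_1+\cdots+x_me_m$.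
   Context: $\mathbb{N}_0=\{0,1,2,\ldots\}$. For $x=(x_1,\ldots,x_m)\in\mathbb{R}^m$ put $|x|_m=\sqrt{x_1^2+\cdots+x_m^2}$. $\mathcal{C}\ell_m$ denotes either the real Clifford algebra $\mathbb{R}_{0,m}$ or the complex one $\mathbb{C}_m$, generated by $e_1,\ldots,e_m$ with $e_j^2=-1$ and $e_ie_j=-e_je_i$ for $i\ne j$; $\mathcal{C}\ell_{m-1}\subset\mathcal{C}\ell_m$ is the subalgebra generated by $e_1,\ldots,e_{m-1}$. A vector $x\in\mathbb{R}^m$ is identified with $x_1e_1+\cdots+x_me_m\in\mathcal{C}\ell_m$, and $\underline{x}$ with $x_1e_1+\cdots+x_{m-1}e_{m-1}$. Write $e_{12}=e_1e_2$. For $\nu>0$, the Gegenbauer polynomials $C^\nu_k$ are determined by $\frac{1}{(1-2th+h^2)^\nu}=\sum_{k=0}^\infty C^\nu_k(t)h^k$ for $|t|\le1$, $|h|<1$. For $m\ge3$ and $n,j\in\mathbb{N}_0$ define $$F^{(n)}_{m,j}(x)=|x|_m^{n}\,C^{m/2+j-1}_{n}(x_m/|x|_m),\quad x\in\mathbb{R}^m,$$ which are polynomials in $x$ (the value at $x=0$ is that of the polynomial; in particular $F^{(0)}_{m,j}=1$), put $F^{(-1)}_{m,j+1}=0$, and define the embedding factors $$X^{(n)}_{m,j}(x)=\frac{m-2+n+2j}{m-2+2j}\,F^{(n)}_{m,j}(x)+F^{(n-1)}_{m,j+1}(x)\,\underline{x}\,e_m,\quad x\in\mathbb{R}^m.$$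 When $X^{(n)}_{r,j}$ with $3\le r\le m$ is applied to $x\in\mathbb{R}^m$, it is evaluated at $(x_1,\ldots,x_r)$. For $k_2\in\mathbb{N}_0$ let $mon_{k_2}(x_1,x_2)=(x_1-e_{12}x_2)^{k_2}/(k_2!)$. For $m\ge2$ and $k=(k_2,\ldots,k_m)\in\mathbb{N}_0^{m-1}$ let $$mon_k(x)=X^{(k_m)}_{m,k^*_{m-1}}X^{(k_{m-1})}_{m-1,k^*_{m-2}}\cdots X^{(k_3)}_{3,k^*_2}\;mon_{k_2}(x_1,x_2),\qquad k^*_r=k_2+\cdots+k_r,$$ with the factors multiplied in this order (for $m=2$ there are no factors $X$). For $x\in\mathbb{R}^m$ and $h=(h_2,\ldots,h_m)\in\mathbb{R}^{m-1}$, the generating function is $$M_m(x,h)=\sum_{k\in\mathbb{N}_0^{m-1}}mon_k(x)\,h^k,\qquad h^k=h_2^{k_2}\cdots h_m^{k_m},$$ defined whenever the series converges absolutely (in the finite-dimensional algebra $\mathcal{C}\ell_m$). *)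

(* Defs.v *)
From HB Require Import structures.
From mathcomp Require Import all_boot all_order all_algebra finmap.
From mathcomp Require Import complex.
From mathcomp Require Import all_classical all_reals all_analysis.
From mathcomp Require Import showcase.summability.

Set Implicit Arguments.
Unset Strict Implicit.
Unset Printing Implicit Defensive.
Import Order.TTheory GRing.Theory Num.Theory.
Import numFieldNormedType.Exports.

Local Open Scope classical_set_scope.
Local Open Scope ring_scope.

Variant clifford_kind := RealClifford | ComplexClifford.

Definition coeff (R : realType) (c : clifford_kind) : fieldType :=
  match c with
  | RealClifford => R
  | ComplexClifford => complex R
  end.

Definition coeff_of_real (R : realType) (c : clifford_kind) : R -> coeff R c :=
  match c with
  | RealClifford => fun a => a
  | ComplexClifford => fun a => Complex a 0
  end.

Definition coeff_norm (R : realType) (c : clifford_kind) : coeff R c -> R :=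
  match c with
  | RealClifford => fun a => `|a|
  | ComplexClifford => fun z => Num.sqrt (complex.Re z ^+ 2 + complex.Im z ^+ 2)
  end.

Section Coeff.
Variables (R : realType) (c : clifford_kind).

Fact coeff_of_real_is_zmod_morphism : zmod_morphism (coeff_of_real (R := R) c).
Proof. by case: c => a b //=; exact: (raddfB (real_complex R)). Qed.

Fact coeff_of_real_is_monoid_morphism :
  monoid_morphism (coeff_of_real (R := R) c).
Proof.
by case: c; split=> //= a b; exact: (rmorphM (real_complex R)).
Qed.

HB.instance Definition _ := GRing.isZmodMorphism.Build R (coeff R c)
  (coeff_of_real c) coeff_of_real_is_zmod_morphism.
HB.instance Definition _ := GRing.isMonoidMorphism.Build R (coeff R c)
  (coeff_of_real c) coeff_of_real_is_monoid_morphism.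

Lemma coeff_norm_ge0 (z : coeff R c) : 0 <= coeff_norm z.
Proof. by case: c z => z //=; rewrite sqrtr_ge0. Qed.

Lemma coeff_normD (y z : coeff R c) :
  coeff_norm (y + z) <= coeff_norm y + coeff_norm z.
Proof.
case: c y z => [|] y z /=; first exact: ler_normD.
by move: (le_normcD (y : Rcomplex R) z); case: y z => [a b] [a' b'].
Qed.

Lemma coeff_norm0_eq0 (z : coeff R c) : coeff_norm z = 0 -> z = 0.
Proof.
case: c z => [|] z /=; first exact: normr0_eq0.
by move=> h; apply: (@Normc.eq0_normc R); move: h; case: z.
Qed.

Lemma coeff_normZ (a : R) (z : coeff R c) :
  coeff_norm (coeff_of_real c a * z) = `|a| * coeff_norm z.
Proof.
case: c z => [|] z /=; first exact: normrM.
case: z => x y /=; rewrite !mul0r subr0 addr0 !exprMn -mulrDr.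
by rewrite sqrtrM ?sqr_ge0// sqrtr_sqr.
Qed.

End Coeff.

Section Blades.
Variable m : nat.
Implicit Types A B C : {set 'I_m}.

Definition symd A B : {set 'I_m} := (A :\: B) :|: (B :\: A).

Lemma in_symd A B i : (i \in symd A B) = (i \in A) (+) (i \in B).
Proof. by rewrite !inE; case: (i \in A); case: (i \in B). Qed.

Lemma symdA A B C : symd A (symd B C) = symd (symd A B) C.
Proof. by apply/setP=> i; rewrite !in_symd addbA. Qed.

Lemma symd0s A : symd finset.set0 A = A.
Proof. by apply/setP=> i; rewrite in_symd !inE. Qed.

Lemma symds0 A : symd A finset.set0 = A.
Proof. by apply/setP=> i; rewrite in_symd !inE addbF. Qed.

(* Sorting e_A e_B requires one sign for each pair (i in A, j in B) with j < i
   (a transposition) and one for each i in A :&: B (since e_i ^ 2 = -1). *)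
Definition inversions A B : nat := \sum_(i in A) \sum_(j in B) (j <= i).

Lemma odd_sum_symd A B (f : 'I_m -> nat) :
  odd (\sum_(i in symd A B) f i) =
  odd (\sum_(i in A) f i) (+) odd (\sum_(i in B) f i).
Proof.
rewrite !(big_morph odd oddD (erefl : odd 0 = false)).
rewrite [LHS]big_mkcond [in RHS]big_mkcond [X in _ = _ (+) X]big_mkcond.
rewrite -big_split; apply: eq_bigr => i _.
by rewrite in_symd; case: (i \in A); case: (i \in B); case: (odd (f i)).
Qed.

Lemma odd_inversionsl A B C :
  odd (inversions (symd A B) C) = odd (inversions A C) (+) odd (inversions B C).
Proof. exact: odd_sum_symd. Qed.

Lemma odd_inversionsr A B C :
  odd (inversions A (symd B C)) = odd (inversions A B) (+) odd (inversions A C).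
Proof.
rewrite /inversions ![\sum_(i in A) _]exchange_big; exact: odd_sum_symd.
Qed.

End Blades.

(* An element is its family of coordinates in the basis of the blades
   e_A = e_(i_1) ... e_(i_r), where A = {i_1 < ... < i_r} and e_A e_B =
   (-1) ^ inversions A B * e_(A symd B).  As everything below only involves real
   scalars, the complex algebra too is made an algebra over R. *)

Definition clifford (R : realType) (c : clifford_kind) (m : nat) :=
  {ffun {set 'I_m} -> coeff R c}.

Section CliffordAlgebra.
Variables (R : realType) (c : clifford_kind) (m : nat).
Local Notation Cl := (clifford R c m).
Local Notation K := (coeff R c).
Implicit Types (x y z : Cl) (A B C : {set 'I_m}).

HB.instance Definition _ := GRing.Zmodule.on Cl.

Definition blade A : Cl := [ffun B => (B == A)%:R].

Definition cl_mul x y : Cl := [ffun C =>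
  \sum_A \sum_(B | symd A B == C) (-1) ^+ inversions A B * (x A * y B)].

Fact cl_mulE (G : {set 'I_m} -> K) x y :
  \sum_C G C * cl_mul x y C =
  \sum_A \sum_B G (symd A B) * ((-1) ^+ inversions A B * (x A * y B)).
Proof.
under eq_bigr => C _.
  rewrite ffunE mulr_sumr.
  under eq_bigr => A _ do rewrite mulr_sumr big_mkcond /=.
  over.
rewrite exchange_big; apply: eq_bigr => A _ /=.
rewrite exchange_big; apply: eq_bigr => B _ /=.
rewrite (bigD1 (symd A B)) //= eqxx big1 ?addr0 // => C nC.
by rewrite eq_sym (negPf nC).
Qed.

Fact cl_mulA : associative cl_mul.
Proof.
move=> x y z; apply/ffunP => D.
have sgnE (a b : nat) : odd a = odd b -> (-1) ^+ a = (-1) ^+ b :> K.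
  by move=> h; rewrite -(signr_odd _ a) h signr_odd.
transitivity (\sum_A \sum_B \sum_C
   (if symd A (symd B C) == D then
     (-1) ^+ (inversions A (symd B C) + inversions B C) * (x A * y B * z C)
    else 0 : K)).
  rewrite ffunE; apply: eq_bigr => A _; rewrite big_mkcond /=.
  pose G C := if symd A C == D then (-1) ^+ inversions A C * x A else 0 : K.
  transitivity (\sum_C G C * cl_mul y z C).
    by apply: eq_bigr => C _; rewrite /G; case: ifP; rewrite ?mul0r ?mulrA.
  rewrite cl_mulE; apply: eq_bigr => B _; apply: eq_bigr => C _.
  rewrite /G; case: ifP => _; rewrite ?mul0r // exprD.
  by rewrite !mulrA; congr (_ * _ * _); rewrite mulrAC.
rewrite ffunE.
transitivity (\sum_C \sum_E
   (if symd E C == D then (-1) ^+ inversions E C * z C else 0) * cl_mul x y E).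
  under [RHS]eq_bigr => C _ do rewrite cl_mulE.
  rewrite [RHS]exchange_big; apply: eq_bigr => A _ /=.
  rewrite [RHS]exchange_big; apply: eq_bigr => B _ /=.
  apply: eq_bigr => C _; rewrite symdA; case: ifP => _; rewrite ?mul0r //.
  rewrite (sgnE _ (inversions (symd A B) C + inversions A B)%N); last first.
    rewrite !oddD odd_inversionsl odd_inversionsr.
    by do 3 case: (odd _).
  rewrite exprD -!mulrA; congr (_ * _).
  rewrite [RHS]mulrC -!mulrA; congr (_ * _).
rewrite exchange_big; apply: eq_bigr => E _ /=.
rewrite [RHS]big_mkcond /=; apply: eq_bigr => C _; case: ifP => _.
  by rewrite -!mulrA; congr (_ * _); rewrite mulrC.
by rewrite mul0r.
Qed.

Fact cl_mul1l : left_id (blade finset.set0) cl_mul.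
Proof.
move=> x; apply/ffunP => C; rewrite ffunE (bigD1 finset.set0) //=.
rewrite (bigD1 C) ?symd0s //= /inversions big_set0 ffunE eqxx !mul1r.
rewrite big1 => [|B /andP[/eqP <-]]; last by rewrite symd0s eqxx.
rewrite big1 ?addr0 // => A /negPf nA; rewrite big1 // => B _.
by rewrite ffunE nA mul0r mulr0.
Qed.

Fact cl_mul1r : right_id (blade finset.set0) cl_mul.
Proof.
move=> x; apply/ffunP => C; rewrite ffunE (bigD1 C) //=.
rewrite (bigD1 finset.set0) ?symds0 //= /inversions ffunE eqxx mulr1.
rewrite big1 => [|i _]; last by rewrite big_set0.
rewrite mul1r big1 => [|B /andP[_ /negPf nB]]; last first.
  by rewrite ffunE nB !mulr0.
rewrite addr0 big1 ?addr0 // => A nA; rewrite big1 // => B /eqP AB.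
rewrite ffunE; case: eqP => [B0|_]; last by rewrite !mulr0.
by move: nA; rewrite -AB B0 symds0 eqxx.
Qed.

Fact cl_mulDl : left_distributive cl_mul +%R.
Proof.
move=> x y z; apply/ffunP => C; rewrite !ffunE -big_split.
apply: eq_bigr => A _; rewrite -big_split; apply: eq_bigr => B _ /=.
by rewrite !ffunE mulrDl mulrDr.
Qed.

Fact cl_mulDr : right_distributive cl_mul +%R.
Proof.
move=> x y z; apply/ffunP => C; rewrite !ffunE -big_split.
apply: eq_bigr => A _; rewrite -big_split; apply: eq_bigr => B _ /=.
by rewrite !ffunE !mulrDr.
Qed.

Fact cl_1neq0 : blade finset.set0 != 0 :> Cl.
Proof.
by apply/eqP => /ffunP/(_ finset.set0)/eqP; rewrite !ffunE eqxx oner_eq0.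
Qed.

HB.instance Definition _ := GRing.Zmodule_isNzRing.Build Cl
  cl_mulA cl_mul1l cl_mul1r cl_mulDl cl_mulDr cl_1neq0.

Definition cl_scale (a : R) x : Cl := [ffun A => coeff_of_real c a * x A].

Fact cl_scaleA a b x : cl_scale a (cl_scale b x) = cl_scale (a * b) x.
Proof. by apply/ffunP => A; rewrite !ffunE rmorphM mulrA. Qed.

Fact cl_scale1 : left_id 1 cl_scale.
Proof. by move=> x; apply/ffunP => A; rewrite ffunE rmorph1 mul1r. Qed.

Fact cl_scaleDr : right_distributive cl_scale +%R.
Proof. by move=> a x y; apply/ffunP => A; rewrite !ffunE mulrDr. Qed.

Fact cl_scaleDl x : {morph cl_scale^~ x : a b / a + b}.
Proof. by move=> a b; apply/ffunP => A; rewrite !ffunE rmorphD mulrDl. Qed.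

HB.instance Definition _ := GRing.Zmodule_isLmodule.Build R Cl
  cl_scaleA cl_scale1 cl_scaleDr cl_scaleDl.

Fact cl_scaleAl (a : R) x y : a *: (x * y) = a *: x * y.
Proof.
apply/ffunP => C; rewrite !ffunE mulr_sumr; apply: eq_bigr => A _.
rewrite mulr_sumr; apply: eq_bigr => B _; rewrite ffunE.
by rewrite mulrCA !mulrA.
Qed.

Fact cl_scaleAr (a : R) x y : a *: (x * y) = x * (a *: y).
Proof.
apply/ffunP => C; rewrite !ffunE mulr_sumr; apply: eq_bigr => A _.
rewrite mulr_sumr; apply: eq_bigr => B _; rewrite ffunE.
by rewrite mulrCA [in RHS](mulrCA (x A)).
Qed.

HB.instance Definition _ := GRing.Lmodule_isLalgebra.Build R Cl cl_scaleAl.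
HB.instance Definition _ := GRing.Lalgebra_isAlgebra.Build R Cl cl_scaleAr.

(* Cl is finite-dimensional, so the choice of norm is immaterial; this one is
   submultiplicative. *)
Definition cl_norm x : R := \sum_A coeff_norm (x A).

Fact cl_normD x y : cl_norm (x + y) <= cl_norm x + cl_norm y.
Proof.
by rewrite -big_split; apply: ler_sum => A _; rewrite ffunE coeff_normD.
Qed.

Fact cl_normZ (a : R) x : cl_norm (a *: x) = `|a| * cl_norm x.
Proof.
by rewrite /cl_norm mulr_sumr; apply: eq_bigr => A _; rewrite ffunE coeff_normZ.
Qed.

Fact cl_norm0_eq0 x : cl_norm x = 0 -> x = 0.
Proof.
move=> /eqP; rewrite psumr_eq0 => [|A _]; last exact: coeff_norm_ge0.
move=> /allP h; apply/ffunP => A; rewrite ffunE; apply: coeff_norm0_eq0.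
by apply/eqP/h; rewrite mem_index_enum.
Qed.

HB.instance Definition _ := Lmodule_isNormed.Build R Cl
  cl_normD cl_normZ cl_norm0_eq0.

End CliffordAlgebra.

(* The generator e_j, for 1 <= j <= m (and 0 for other values of j). *)
Definition cl_gen (R : realType) (c : clifford_kind) (m j : nat) :
    clifford R c m :=
  \sum_(i < m | i.+1 == j) blade R c [set i]%SET.

(* relabel and cl_incl are only meaningful for n <= m. *)
Definition relabel (n m : nat) (A : {set 'I_n}) : {set 'I_m} :=
  [set j : 'I_m | [exists i in A, val i == val j]]%SET.

Definition cl_incl (R : realType) (c : clifford_kind) (n m : nat)
    (x : clifford R c n) : clifford R c m :=
  [ffun B : {set 'I_m} => \sum_(A | relabel m A == B) x A].

Section CliffordFacts.
Variables (R : realType) (c : clifford_kind).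

Lemma blade0 m : blade R c finset.set0 = 1 :> clifford R c m.
Proof. by []. Qed.

Lemma blade_mul m (A B : {set 'I_m}) :
  blade R c A * blade R c B = (-1) ^+ inversions A B *: blade R c (symd A B).
Proof.
apply/ffunP => C; rewrite !ffunE (bigD1 A) //= [X in _ + X]big1 ?addr0.
  have [->|nC] := eqVneq C (symd A B).
    rewrite (bigD1 B) //= [X in _ + X]big1 ?addr0.
      by rewrite !ffunE !eqxx !mulr1 rmorphXn rmorphN1.
    by move=> D /andP[_ /negPf nD]; rewrite !ffunE nD !mulr0.
  rewrite mulr0 big1 // => D /eqP AD; rewrite !ffunE eqxx.
  by case: eqP => [DB|_]; rewrite ?mulr0 //; rewrite -AD DB eqxx in nC.
by move=> D /negPf nD; rewrite big1 // => E _; rewrite !ffunE nD mul0r mulr0.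
Qed.

Lemma cl_genE m (i : 'I_m) : cl_gen R c m i.+1 = blade R c [set i]%SET.
Proof.
rewrite /cl_gen (bigD1 i) //= big1 ?addr0 // => j /andP[/eqP[ji]].
by rewrite -val_eqE /= ji eqxx.
Qed.

Lemma inversions1 m (i j : 'I_m) :
  inversions [set i]%SET [set j]%SET = (j <= i)%N.
Proof. by rewrite /inversions !big_set1. Qed.

Lemma cl_gen_sqr m (i : 'I_m) :
  cl_gen R c m i.+1 * cl_gen R c m i.+1 = -1.
Proof.
rewrite cl_genE blade_mul inversions1 leqnn expr1 scaleN1r -blade0.
congr (- blade R c _); apply/setP => k.
by rewrite in_symd addbb finset.inE.
Qed.

Lemma cl_gen_anticomm m (i j : 'I_m) : i != j ->
  cl_gen R c m i.+1 * cl_gen R c m j.+1 =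
  - (cl_gen R c m j.+1 * cl_gen R c m i.+1).
Proof.
move=> ij; rewrite !cl_genE !blade_mul !inversions1.
have -> : symd [set j]%SET [set i]%SET = symd [set i]%SET [set j]%SET.
  by apply/setP => k; rewrite !in_symd addbC.
rewrite -scaleNr; congr (_ *: _).
by case: ltngtP ij => [||/val_inj->]; rewrite ?eqxx //= ?opprK // expr0 expr1.
Qed.

Lemma in_relabel n m (le_nm : (n <= m)%N) (A : {set 'I_n}) (i : 'I_n) :
  (widen_ord le_nm i \in relabel m A) = (i \in A).
Proof.
rewrite finset.inE; apply/idP/idP => [/exists_inP[j jA /eqP ij]|iA].
  by have <- : j = i by exact: val_inj.
by apply/exists_inP; exists i.
Qed.

Lemma relabelE n m (le_nm : (n <= m)%N) (A : {set 'I_n}) :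
  relabel m A = (widen_ord le_nm @: A)%SET.
Proof.
apply/setP => j; rewrite finset.inE; apply/exists_inP/imsetP => -[i iA ij].
  by exists i => //; apply: val_inj; rewrite /= (eqP ij).
by exists i => //; rewrite ij.
Qed.

Lemma relabel_inj n m : (n <= m)%N -> injective (@relabel n m).
Proof.
by move=> le_nm A B AB; apply/setP => i; rewrite -!(in_relabel le_nm) AB.
Qed.

Lemma relabel_symd n m (A B : {set 'I_n}) : (n <= m)%N ->
  relabel m (symd A B) = symd (relabel m A) (relabel m B).
Proof.
move=> le_nm; apply/setP => j; rewrite in_symd.
have [jn|nj] := ltnP j n.
  have -> : j = widen_ord le_nm (Ordinal jn) by exact: val_inj.
  by rewrite !in_relabel in_symd.
have F (C : {set 'I_n}) : (j \in relabel m C) = false.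
  rewrite finset.inE; apply/negbTE/exists_inP => -[i _ /eqP ij].
  by move: (ltn_ord i); rewrite [nat_of_ord i]ij ltnNge nj.
by rewrite !F.
Qed.

Lemma inversions_relabel n m (A B : {set 'I_n}) : (n <= m)%N ->
  inversions (relabel m A) (relabel m B) = inversions A B.
Proof.
move=> le_nm; have wi : injective (widen_ord le_nm).
  by move=> i j /(congr1 val) /= /val_inj.
rewrite /inversions !(relabelE le_nm) big_imset /=; last by move=> ? ? _ _ /wi.
apply: eq_bigr => i _; rewrite big_imset //=; by move=> ? ? _ _ /wi.
Qed.

Lemma cl_incl_relabel n m (x : clifford R c n) A : (n <= m)%N ->
  cl_incl m x (relabel m A) = x A.
Proof.
move=> le_nm; rewrite ffunE (bigD1 A) //= big1 ?addr0 // => B /andP[/eqP h].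
by rewrite (relabel_inj le_nm h) eqxx.
Qed.

Lemma cl_incl_blade n m A : (n <= m)%N ->
  cl_incl m (blade R c A : clifford R c n) = blade R c (relabel m A).
Proof.
move=> le_nm; apply/ffunP => B; rewrite !ffunE.
rewrite big_mkcond (bigD1 A) //= big1 ?addr0 => [|C /negPf nC]; last first.
  by rewrite ffunE nC; case: ifP.
by rewrite ffunE eqxx eq_sym; case: eqP.
Qed.

Lemma cl_incl_gen n m (i : 'I_n) : (n <= m)%N ->
  cl_incl m (cl_gen R c n i.+1) = cl_gen R c m i.+1.
Proof.
move=> le_nm; rewrite cl_genE cl_incl_blade // relabelE imset_set1.
by rewrite -cl_genE.
Qed.

Lemma cl_inclD n m (x y : clifford R c n) :
  cl_incl m (x + y) = cl_incl m x + cl_incl m y.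
Proof.
apply/ffunP => B; rewrite !ffunE -big_split.
by apply: eq_bigr => A _; rewrite ffunE.
Qed.

Lemma cl_inclZ n m (a : R) (x : clifford R c n) :
  cl_incl m (a *: x) = a *: cl_incl m x.
Proof.
apply/ffunP => B; rewrite !ffunE mulr_sumr.
by apply: eq_bigr => A _; rewrite ffunE.
Qed.

Lemma cl_incl1 n m : (n <= m)%N -> cl_incl m (1 : clifford R c n) = 1.
Proof.
by move=> le_nm; rewrite -blade0 cl_incl_blade // relabelE imset0 blade0.
Qed.

Lemma cl_inclM n m (x y : clifford R c n) : (n <= m)%N ->
  cl_incl m (x * y) = cl_incl m x * cl_incl m y.
Proof.
move=> le_nm; apply/ffunP => C; rewrite [LHS]ffunE [RHS]ffunE.
under eq_bigr do rewrite ffunE.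
rewrite big_mkcond /=.
transitivity (\sum_A \sum_B (if relabel m (symd A B) == C
    then (-1) ^+ inversions A B * (x A * y B) else 0)).
  transitivity (\sum_D (relabel m D == C)%:R * (x * y) D).
    by apply: eq_bigr => D _; case: eqP => _; rewrite ?mul1r ?mul0r // ffunE.
  rewrite cl_mulE; apply: eq_bigr => A _; apply: eq_bigr => B _.
  by case: eqP => _; rewrite ?mul1r ?mul0r.
have sumE (G : {set 'I_m} -> coeff R c) (z : clifford R c n) :
    \sum_D G D * cl_incl m z D = \sum_A G (relabel m A) * z A.
  under eq_bigr => D _ do rewrite ffunE mulr_sumr big_mkcond.
  rewrite exchange_big; apply: eq_bigr => A _ /=.
  rewrite (bigD1 (relabel m A)) //= eqxx big1 ?addr0 // => D nD.
  by rewrite eq_sym (negPf nD).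
symmetry; pose H A := \sum_(B | symd A B == C)
  (-1) ^+ inversions A B * cl_incl m y B.
transitivity (\sum_A H A * cl_incl m x A).
  apply: eq_bigr => A _; rewrite mulr_suml; apply: eq_bigr => B _.
  by rewrite -mulrA [cl_incl m y B * _]mulrC.
rewrite sumE; apply: eq_bigr => A _; rewrite /H big_mkcond /=.
pose G B := if symd (relabel m A) B == C
  then (-1) ^+ inversions (relabel m A) B else 0 : coeff R c.
transitivity ((\sum_B G B * cl_incl m y B) * x A).
  by congr (_ * _); apply: eq_bigr => B _; rewrite /G; case: ifP; rewrite ?mul0r.
rewrite sumE mulr_suml; apply: eq_bigr => B _.
rewrite /G -relabel_symd // inversions_relabel //; case: ifP => _.
  by rewrite -mulrA [y B * _]mulrC.
by rewrite !mul0r.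
Qed.

End CliffordFacts.

(* The coordinates of x in R^m are numbered from 1 to m; those of
   h = (h_2, ..., h_m) in R^(m-1) and of k = (k_2, ..., k_m) from 2 to m. *)

Definition xcoord (R : realType) (m : nat) (x : 'rV[R]_m) (j : nat) : R :=
  \sum_(i < m | i.+1 == j) x 0 i.

Definition hcoord (R : realType) (m : nat) (h : 'rV[R]_m.-1) (j : nat) : R :=
  \sum_(i < m.-1 | i.+2 == j) h 0 i.

Definition kcoord (m : nat) (k : {ffun 'I_m.-1 -> nat}) (j : nat) : nat :=
  \sum_(i < m.-1 | i.+2 == j) k i.

Definition kstar (m : nat) (k : {ffun 'I_m.-1 -> nat}) (r : nat) : nat :=
  \sum_(i < m.-1 | (i.+2 <= r)%N) k i.

Definition enorm (R : realType) (m : nat) (x : 'rV[R]_m) : R :=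
  Num.sqrt (\sum_i x 0 i ^+ 2).

Definition trunc (R : realType) (n r : nat) (v : 'rV[R]_n) : 'rV[R]_r :=
  \row_(i < r) xcoord v i.+1.

Definition cl_vec (R : realType) (c : clifford_kind) (m : nat) (x : 'rV[R]_m) :
    clifford R c m :=
  \sum_(i < m) x 0 i *: cl_gen R c m i.+1.

Definition gegenbauer_family (R : realType) (nu : R) (C : nat -> {poly R}) :=
  forall t h : R, `|t| <= 1 -> `|h| < 1 ->
    series (fun k => (C k).[t] * h ^+ k) @ \oo
      --> (1 - 2 * t * h + h ^+ 2) `^ (- nu).

(* Meaningful for nu > 0, where such a family exists and is unique. *)
Definition gegenbauer (R : realType) (nu : R) : nat -> {poly R} :=
  xget (fun=> 0) [set C | gegenbauer_family nu C].

(* At x = 0 the conventions 0 / 0 = 0 and 0 ^+ 0 = 1 give C_0(0) = 1 when n = 0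
   and 0 when n > 0, i.e. the value at 0 of the polynomial F. *)
Definition Ffun (R : realType) (m n j : nat) (x : 'rV[R]_m) : R :=
  enorm x ^+ n *
  (gegenbauer (m%:R / 2 + j%:R - 1) n).[xcoord x m / enorm x].

(* The case n = 0 is F^(-1) = 0. *)
Definition Ffun_pred (R : realType) (m n j : nat) (x : 'rV[R]_m) : R :=
  if n is n'.+1 then Ffun n' j x else 0.

Definition Xfactor (R : realType) (c : clifford_kind) (m n j : nat)
    (x : 'rV[R]_m) : clifford R c m :=
  ((m%:R - 2 + n%:R + 2 * j%:R) / (m%:R - 2 + 2 * j%:R) * Ffun n j x)%:A
  + Ffun_pred n j.+1 x *:
      (cl_incl m (cl_vec c (trunc m.-1 x)) * cl_gen R c m m).

Definition mon2 (R : realType) (c : clifford_kind) (m k2 : nat) (x1 x2 : R) :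
    clifford R c m :=
  (k2`!%:R)^-1 *:
    (x1%:A - cl_gen R c m 1 * cl_gen R c m 2 * x2%:A) ^+ k2.

(* The product runs over r = m, m - 1, ..., 3, in this order. *)
Definition mon (R : realType) (c : clifford_kind) (m : nat)
    (k : {ffun 'I_m.-1 -> nat}) (x : 'rV[R]_m) : clifford R c m :=
  (\prod_(r <- rev (iota 3 (m - 2)))
     cl_incl m (Xfactor c (kcoord k r) (kstar k r.-1) (trunc r x)))
  * mon2 c m (kcoord k 2) (xcoord x 1) (xcoord x 2).

Definition hpow (R : realType) (n : nat) (h : 'rV[R]_n)
    (k : {ffun 'I_n -> nat}) : R :=
  \prod_i h 0 i ^+ k i.

Definition genfun_term (R : realType) (c : clifford_kind) (m : nat)
    (x : 'rV[R]_m) (h : 'rV[R]_m.-1) (k : {ffun 'I_m.-1 -> nat}) :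
    clifford R c m :=
  hpow h k *: mon c k x.

Definition genfun_defined (R : realType) (c : clifford_kind) (m : nat)
    (x : 'rV[R]_m) (h : 'rV[R]_m.-1) : Prop :=
  summability.summable (genfun_term c x h).

Definition genfun (R : realType) (c : clifford_kind) (m : nat)
    (x : 'rV[R]_m) (h : 'rV[R]_m.-1) : clifford R c m :=
  summability.sum (genfun_term c x h).

Definition partials (R : realType) (n : nat) (W : normedModType R)
    (s : seq 'I_n) (f : 'rV[R]_n -> W) : 'rV[R]_n -> W :=
  foldr (fun i g h => 'D_(delta_mx 0 i) g h) f s.

Fixpoint partials_exist (R : realType) (n : nat) (W : normedModType R)
    (s : seq 'I_n) (f : 'rV[R]_n -> W) (a : 'rV[R]_n) : Prop :=
  if s is i :: s' then
    partials_exist s' f a /\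
    \forall h \near a, derivable (partials s' f) h (delta_mx 0 i)
  else True.

(* The multi-index k as a list of directions, outermost derivative first. *)
Definition directions (n : nat) (k : {ffun 'I_n -> nat}) : seq 'I_n :=
  flatten [seq nseq (k i) i | i <- enum 'I_n].

Definition mfact (n : nat) (k : {ffun 'I_n -> nat}) : nat := \prod_i (k i)`!.

(* Main.v *)
From HB Require Import structures.
Require Import Defs.
From mathcomp Require Import all_boot all_order all_algebra finmap.
From mathcomp Require Import complex ring lra zify.
From mathcomp Require Import all_classical all_reals all_analysis.
From mathcomp Require Import showcase.summability.

(* Summing over the last index first reduces (iii) to a one-variable identity.
   With nu = m/2 + j - 1, the generating function of the Gegenbauer polynomials
   C^nu_n and its derivative in h give
     \sum_n h^n X^(n)_(m,j)(x) = (1 + h x e_m) d^(- m/2 - j),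
   and, as j = k_2 + ... + k_(m-1), the factor d^(- j) turns the remaining
   variables h into h / d.  The interchange of sums and (i) follow from a bound
   |mon_k(x)| <= M C^(k_2 + ... + k_m), uniform in the unit ball, which comes from
   |C^nu_n(t)| <= 2^(2 nu + n) on [-1, 1]; (ii) is termwise differentiation.

   That the C^nu_n exist, with this bound, rests on the logarithmic derivative
     d/dh log (1 - 2 t h + h^2)^(- nu) = 2 nu \sum_n T_(n+1)(t) h^n,
   T_n being the Chebyshev polynomials: as |T_n| <= 1 on [-1, 1], the series is
   majorized by that of (1 - h)^(- 2 nu). *)

Set Implicit Arguments.
Unset Strict Implicit.
Unset Printing Implicit Defensive.
Import Order.TTheory GRing.Theory Num.Theory.
Import numFieldNormedType.Exports.
Local Open Scope classical_set_scope.
Local Open Scope ring_scope.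

(** * Unconditional sums *)

(* Three obstacles shape the development. The Gegenbauer family of the statement is obtained by
   choice, so that only its generating function is known: besides existence, uniqueness of power
   series coefficients is needed, and since [Ffun] evaluates the polynomials only at points of
   $[-1,1]$, it is enough to compare values there. The algebra is not commutative: $X^{(k_m)}$
   stands to the left of all other factors and depends on their indices only through the sum $j$, so
   that the inner sum is a Clifford element independent of these indices times the real scalar
   $d^{-m/2-j}$, which commutes with everything. Finally, the neighborhood must not depend on $x$:
   every estimate is uniform on the closed unit ball. There $|h_m|\le 1/8$ forces $d\ge 1/4$, so
   that passing from $h$ to $h/d$ enlarges coordinates at most four times, and a cube adapted to the
   bounds in dimensions $m$ and $m-1$ serves as $U_m$. *)
#[local] Existing Instance totally_filter.

Section FiniteSums.
Context {I : choiceType}.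

Lemma big_fsetDI (V : zmodType) (f : I -> V) (A B : {fset I}) :
  (A `<=` B)%fset ->
  \sum_(i <- B) f i = \sum_(i <- A) f i + \sum_(i <- (B `\` A)%fset) f i.
Proof.
move=> AB; rewrite (big_fsetID _ (mem A) B); congr (_ + _); apply: eq_fbigl => i.
  by rewrite !inE /= andbC; case: (boolP (i \in A)) => // /(fsubsetP AB).
by rewrite !inE andbC.
Qed.

Lemma ler_sum_fsubset (R : numDomainType) (g : I -> R) (A B : {fset I}) :
  (forall i, 0 <= g i) -> (A `<=` B)%fset ->
  \sum_(i <- A) g i <= \sum_(i <- B) g i.
Proof. by move=> g0 /big_fsetDI->; rewrite lerDl sumr_ge0. Qed.

Lemma sum_fset_inj (J : choiceType) (V : nmodType) (phi : I -> J) (f : J -> V)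
    (A : {fset I}) : injective phi ->
  \sum_(i <- A) f (phi i) = \sum_(j <- (phi @` A)%fset) f j.
Proof. by move=> phi_inj; rewrite big_imfset //= => i j _ _ /phi_inj. Qed.

End FiniteSums.

Definition bounded_sums (R : realType) (I : choiceType) (g : I -> R) :=
  exists M : R, forall J : {fset I}, \sum_(i <- J) g i <= M.

Definition has_sum (R : realType) (I : choiceType) (V : normedModType R)
  (f : I -> V) (s : V) := partial_sum f @ totally --> s.

Section HasSum.
Context {R : realType}.
Implicit Types I J K : choiceType.

Lemma partial_sumE I (V : zmodType) (f : I -> V) (J : {fset I}) :
  partial_sum f J = \sum_(i <- J) f i.
Proof. by rewrite /partial_sum big_seq_fsetE. Qed.

Lemma has_sumP I (V : normedModType R) (f : I -> V) (s : V) :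
  has_sum f s <->
  (forall e : R, 0 < e -> exists J0 : {fset I}, forall J : {fset I},
     (J0 `<=` J)%fset -> `|s - \sum_(i <- J) f i| <= e).
Proof.
split=> [/cvgrPdist_le h e e0|h].
  by have [J0 _ hJ0] := h e e0; exists J0 => J /hJ0 /=; rewrite partial_sumE.
apply/cvgrPdist_le => e e0; have [J0 hJ0] := h e e0.
by exists J0 => // J J0J; rewrite partial_sumE; exact: hJ0.
Qed.

Lemma summableP I (V : normedModType R) (f : I -> V) :
  summable f <-> bounded_sums (fun i => `|f i|).
Proof.
split=> [[M [_ hM]]|[M hM]].
  have [J0 _ hJ0] : \forall J \near totally,
      partial_sum (fun i => `|f i|) J <= M + 1 by apply: hM; rewrite ltrDl.
  exists (M + 1) => J; apply: le_trans (hJ0 (J0 `|` J)%fset _); last first.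
    by rewrite /= fsubsetUl.
  by rewrite partial_sumE; apply: ler_sum_fsubset => //; rewrite fsubsetUr.
exists M; split; first exact: num_real.
move=> N MN; exists fset0 => // J _; rewrite partial_sumE.
exact: le_trans (hM J) (ltW MN).
Qed.

Lemma le_bounded_sums I (f g : I -> R) :
  (forall i, f i <= g i) -> bounded_sums g -> bounded_sums f.
Proof.
by move=> fg [M hM]; exists M => J; apply: le_trans (hM J); exact: ler_sum.
Qed.

Lemma bounded_sumsZ I (a : R) (f : I -> R) :
  0 <= a -> bounded_sums f -> bounded_sums (fun i => a * f i).
Proof.
by move=> a0 [M hM]; exists (a * M) => J; rewrite -mulr_sumr ler_wpM2l.
Qed.

Lemma bounded_sums_inj I J (phi : I -> J) (f : J -> R) :
  injective phi -> bounded_sums f -> bounded_sums (f \o phi).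
Proof.
by move=> phi_inj [M hM]; exists M => A; rewrite [leLHS](sum_fset_inj f A phi_inj).
Qed.

Lemma le_summable I (V : normedModType R) (f : I -> V) (g : I -> R) :
  (forall i, `|f i| <= g i) -> bounded_sums g -> summable f.
Proof. by move=> fg bg; apply/summableP; exact: le_bounded_sums bg. Qed.

Lemma has_sum_unique I (V : normedModType R) (f : I -> V) (s t : V) :
  has_sum f s -> has_sum f t -> s = t.
Proof. exact: norm_cvg_unique. Qed.

Lemma has_sum_sum I (V : normedModType R) (f : I -> V) (s : V) :
  has_sum f s -> sum f = s.
Proof. by move=> /cvg_lim; exact. Qed.

(** Completeness enters here: if the sum of norms over [J0] is within [e] of the supremum, every
    finite set disjoint from [J0] contributes less than [e], so the partial sums form a Cauchy
    filter. *)
Lemma summable_has_sum I (V : completeNormedModType R) (f : I -> V) :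
  summable f -> has_sum f (sum f).
Proof.
move=> /summableP[M hM]; apply: cauchy_cvg; apply: cauchy_exP => e e0.
pose S := [set \sum_(i <- J) `|f i| | J in [set: {fset I}]].
have S_sup : has_sup S.
  by split; [exists (\sum_(i <- fset0) `|f i|), fset0|exists M => _ [J _ <-]].
have [_ [J0 _ <-] hJ0] := sup_adherent e0 S_sup.
exists (\sum_(i <- J0) f i); exists J0 => // J /= J0J.
rewrite partial_sumE -ball_normE /= distrC (big_fsetDI _ J0J) addrC addKr.
apply: le_lt_trans (ler_norm_sum _ _ _) _.
have : \sum_(i <- J) `|f i| <= sup S.
  by apply: ub_le_sup; [case: S_sup|exists J].
by rewrite (big_fsetDI _ J0J) => h; lra.
Qed.

Lemma has_sum_norm_le I (V : normedModType R) (f : I -> V) (s : V) (M : R) :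
  has_sum f s -> (forall J : {fset I}, \sum_(i <- J) `|f i| <= M) -> `|s| <= M.
Proof.
move=> /has_sumP fs fM; apply/ler_addgt0Pl => e e0; have [J hJ] := fs e e0.
rewrite -(subrK (\sum_(i <- J) f i) s); apply: le_trans (ler_normD _ _) _.
apply: lerD; first exact: hJ.
exact: le_trans (ler_norm_sum _ _ _) (fM J).
Qed.

Lemma has_sumD I (V : normedModType R) (f g : I -> V) (s t : V) :
  has_sum f s -> has_sum g t -> has_sum (fun i => f i + g i) (s + t).
Proof.
move=> fs gt; rewrite /has_sum.
have -> : partial_sum (fun i => f i + g i) = partial_sum f \+ partial_sum g.
  by apply/funext => J; rewrite /= /partial_sum -big_split.
exact: cvgD.
Qed.

Lemma has_sumN I (V : normedModType R) (f : I -> V) (s : V) :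
  has_sum f s -> has_sum (fun i => - f i) (- s).
Proof.
move=> fs; rewrite /has_sum.
have -> : partial_sum (fun i => - f i) = - partial_sum f.
  by apply/funext => J; rewrite /partial_sum sumrN.
exact: cvgN.
Qed.

Lemma has_sumB I (V : normedModType R) (f g : I -> V) (s t : V) :
  has_sum f s -> has_sum g t -> has_sum (fun i => f i - g i) (s - t).
Proof. by move=> fs gt; apply: has_sumD => //; exact: has_sumN. Qed.

Lemma has_sumZ I (V : normedModType R) (a : R) (f : I -> V) (s : V) :
  has_sum f s -> has_sum (fun i => a *: f i) (a *: s).
Proof.
move=> fs; rewrite /has_sum.
have -> : partial_sum (fun i => a *: f i) = a \*: partial_sum f.
  by apply/funext => J; rewrite /partial_sum -scaler_sumr.
exact: cvgZr.
Qed.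

Lemma has_sum_scale I (V : normedModType R) (f : I -> R^o) (s : R) (v : V) :
  has_sum f s -> has_sum (fun i => (f i : R) *: v) (s *: v).
Proof.
move=> fs; rewrite /has_sum.
have -> : partial_sum (fun i => (f i : R) *: v) =
    (fun A : {fset I} => (partial_sum f A : R) *: v).
  by apply/funext => J; rewrite /partial_sum -scaler_suml.
exact: cvgZl.
Qed.

(** Bounded additive maps pass through sums; applied to left and right multiplication in the
    Clifford algebra and to the inclusion of a smaller algebra. *)
Lemma has_sum_additive I (V W : normedModType R) (L : V -> W) (K : R)
    (f : I -> V) (s : V) : {morph L : u v / u + v} ->
  (forall v, `|L v| <= K * `|v|) -> has_sum f s -> has_sum (fun i => L (f i)) (L s).
Proof.
move=> LD LK /has_sumP fs; apply/has_sumP => e e0.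
have K0 : 0 < `|K| + 1 by apply: ltr_wpDl.
have L0 : L 0 = 0 by apply: (addrI (L 0)); rewrite -LD !addr0.
have LB u v : L u - L v = L (u - v) by apply/eqP; rewrite subr_eq -LD subrK.
have [J0 hJ0] := fs (e / (`|K| + 1)) (divr_gt0 e0 K0); exists J0 => J /hJ0 h.
rewrite -(big_morph L LD L0) LB; apply: le_trans (LK _) _.
apply: le_trans (_ : (`|K| + 1) * (e / (`|K| + 1)) <= _); last first.
  by rewrite mulrC divfK // gt_eqF.
apply: le_trans (_ : (`|K| + 1) * `|s - \sum_(i <- J) f i| <= _).
  by rewrite ler_wpM2r // (le_trans (ler_norm K)) // lerDl.
by rewrite ler_wpM2l // ltW.
Qed.

Lemma eq_has_sum I (V : normedModType R) (f g : I -> V) (s : V) :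
  f =1 g -> has_sum f s -> has_sum g s.
Proof. by move=> /funext ->. Qed.

Lemma fset_preimage I J (phi : I -> J) (B : {fset J}) : injective phi ->
  exists A : {fset I}, forall i, (i \in A) = (phi i \in B).
Proof.
move=> phi_inj.
have /finite_fsetP[A hA] : finite_set (phi @^-1` [set` B]).
  by apply: finite_preimage => // i j _ _; exact: phi_inj.
exists A => i; apply/idP/idP => h.
  by have : (phi @^-1` [set` B]) i by rewrite hA.
by have : [set` A] i by rewrite -hA.
Qed.

(** A finite set containing the image of [A] has a finite preimage containing [A], and the terms
    outside the image vanish. This justifies index shifts, in derivatives and in $F^{(n-1)}$. *)
Lemma has_sum_inj I J (V : normedModType R) (phi : I -> J) (f : J -> V) (s : V) :
  injective phi -> (forall j, (forall i, phi i != j) -> f j = 0) ->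
  has_sum (f \o phi) s -> has_sum f s.
Proof.
move=> phi_inj f0 /has_sumP fs; apply/has_sumP => e e0.
have [A hA] := fs e e0; exists (phi @` A)%fset => B AB.
have [A' hA'] := fset_preimage B phi_inj.
have -> : \sum_(j <- B) f j = \sum_(i <- A') f (phi i).
  rewrite (sum_fset_inj f _ phi_inj); apply/esym/big_fset_incl.
    by apply/fsubsetP => j /imfsetP[i /= iA' ->]; rewrite -hA'.
  move=> j jB jA'; apply: f0 => i; apply: contraNneq jA' => ij.
  by apply/imfsetP; exists i => //=; rewrite hA' ij.
apply: hA; apply/fsubsetP => i iA; rewrite hA'.
by apply: (fsubsetP AB); rewrite in_imfset.
Qed.

Lemma has_sum_bij I J (V : normedModType R) (phi : I -> J) (f : J -> V) (s : V) :
  bijective phi -> has_sum f s -> has_sum (f \o phi) s.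
Proof.
move=> [psi phiK psiK] fs; apply: (@has_sum_inj _ _ _ psi).
- exact: can_inj psiK.
- by move=> i /(_ (phi i)); rewrite phiK eqxx.
- by apply: eq_has_sum fs => j /=; rewrite psiK.
Qed.

(** Once [A] and [B] contain the two projections of [J0], the sum over the rectangle is within [e]
    of [s]; letting [B] grow with [A] fixed turns the rows into the values of [g]. *)
Lemma has_sum_fubini I J (V : normedModType R) (f : I * J -> V) (g : I -> V)
    (s : V) : has_sum f s -> (forall i, has_sum (fun j => f (i, j)) (g i)) ->
  has_sum g s.
Proof.
move=> /has_sumP fs fg; apply/has_sumP => e e0; have [J0 hJ0] := fs e e0.
exists ([fset p.1 | p in J0])%fset => A hA.
have cv : (fun B => \sum_(i <- A) partial_sum (fun j => f (i, j)) B) @ totally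
    --> \sum_(i <- A) g i.
  apply: cvg_big => [|i _]; [exact: add_continuous|exact: fg].
have cv' : (fun B => `|s - \sum_(i <- A) partial_sum (fun j => f (i, j)) B|)
    @ totally --> `|s - \sum_(i <- A) g i|.
  by apply: cvg_norm; apply: cvgB => //; exact: cvg_cst.
apply: (cvgr_to_le cv').
exists ([fset p.2 | p in J0])%fset => // B /= hB.
under eq_bigr do rewrite partial_sumE.
have -> : \sum_(i <- A) \sum_(j <- B) f (i, j) =
    \sum_(p <- (A `*` B)%fset) f p.
  by rewrite big_imfset2 //= => -[i j] [i' j'] _ _ [/= -> ->].
apply: hJ0; apply/fsubsetP => -[i j] ij; rewrite in_fsetM /=; apply/andP; split.
  by apply: (fsubsetP hA); apply/imfsetP; exists (i, j).
by apply: (fsubsetP hB); apply/imfsetP; exists (i, j).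
Qed.

Lemma has_sum_series (V : normedModType R) (f : nat -> V) (s : V) :
  has_sum f s -> series f @ \oo --> s.
Proof.
move=> /has_sumP fs; apply/cvgrPdist_le => e e0; have [J0 hJ0] := fs e e0.
exists (\max_(i <- J0) i).+1 => //= n hn.
rewrite /series /=.
have -> : \sum_(0 <= k < n) f k = \sum_(k <- [fset k in iota 0 n]%fset) f k.
  by rewrite big_imfset //= undup_id ?iota_uniq // /index_iota subn0.
apply: hJ0; apply/fsubsetP => i iJ0; rewrite !inE /= mem_iota /= add0n.
by apply: leq_ltn_trans hn; exact: leq_bigmax_seq.
Qed.

(** Gives access to the closed forms found as limits of ordinary series: the unconditional sum can
    only be that limit. *)
Lemma series_has_sum (V : completeNormedModType R) (f : nat -> V) (s : V) :
  summable f -> series f @ \oo --> s -> has_sum f s.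
Proof.
move=> /summable_has_sum fs f_s; rewrite (norm_cvg_unique f_s (has_sum_series fs)).
exact: fs.
Qed.

End HasSum.

(** * Power series in several variables *)

Section MultiIndices.
Variable n : nat.
Implicit Types k l : {ffun 'I_n -> nat}.

Definition mdeg k : nat := \sum_i k i.
Definition mincr k (i : 'I_n) : {ffun 'I_n -> nat} := [ffun j => (k j + (j == i))%N].

Lemma mdegD1 k i : mdeg k = (k i + \sum_(j | j != i) k j)%N.
Proof. by rewrite /mdeg (bigD1 i). Qed.

Lemma leq_mdeg k i : (k i <= mdeg k)%N.
Proof. by rewrite (mdegD1 k i) leq_addr. Qed.

Lemma mdeg_mincr k i : mdeg (mincr k i) = (mdeg k).+1.
Proof.
rewrite !(mdegD1 _ i) ffunE eqxx addn1 addSn; congr (_ + _).+1.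
by apply: eq_bigr => j /negPf ji; rewrite ffunE ji addn0.
Qed.

Lemma mincr_inj i : injective (mincr^~ i).
Proof.
move=> k l /ffunP kl; apply/ffunP => j; have := kl j; rewrite !ffunE; exact: addIn.
Qed.

Lemma mfact_mincr k i : mfact (mincr k i) = ((k i).+1 * mfact k)%N.
Proof.
rewrite /mfact (bigD1 i) //= [in RHS](bigD1 i) //= mulnA -factS.
rewrite ffunE eqxx addn1; congr (_ * _)%N.
by apply: eq_bigr => j /negPf ji; rewrite ffunE ji addn0.
Qed.

Lemma sum_geometric_le (R : realFieldType) (a : R) N : 0 <= a -> a < 1 ->
  \sum_(j < N) a ^+ j <= (1 - a)^-1.
Proof.
move=> a0 a1; have a1' : 0 < 1 - a by rewrite subr_gt0.
have h : (1 - a) * \sum_(j < N) a ^+ j = 1 - a ^+ N.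
  by rewrite -[1 - a]opprB mulNr -subrX1 opprB.
by rewrite -[leRHS]mul1r ler_pdivlMr // mulrC h lerBlDr lerDl exprn_ge0.
Qed.

(** A finite set of multi-indices lies in a cube, over which the sum factors into [n] one-variable
    geometric sums. *)
Lemma bounded_sums_geometric (R : realType) (a : R) : 0 <= a -> a < 1 ->
  bounded_sums (fun k => a ^+ mdeg k).
Proof.
move=> a0 a1; exists ((1 - a)^-1 ^+ n) => J.
pose N := (\max_(k <- J) mdeg k).+1.
pose phi (g : {ffun 'I_n -> 'I_N}) : {ffun 'I_n -> nat} := [ffun i => g i : nat].
have phi_inj : injective phi.
  move=> g g' /ffunP gg'; apply/ffunP => i; apply: val_inj.
  by have := gg' i; rewrite !ffunE.
apply: (@le_trans _ _ (\sum_(k <- [fset phi g | g in {ffun 'I_n -> 'I_N}]%fset)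
    a ^+ mdeg k)).
  apply: ler_sum_fsubset => [k|]; first by rewrite exprn_ge0.
  apply/fsubsetP => k kJ; apply/imfsetP; exists [ffun i => inord (k i)] => //.
  apply/ffunP => i; rewrite !ffunE inordK // ltnS.
  exact: leq_trans (leq_mdeg k i) (leq_bigmax_seq _ kJ _).
rewrite big_imfset /=; last by move=> g g' _ _ /phi_inj.
apply: (@le_trans _ _ (\sum_(g : {ffun 'I_n -> 'I_N}) \prod_i a ^+ g i)).
  rewrite big_enum /=; apply: ler_sum => g _; rewrite /mdeg -prodrXr.
  by apply: ler_prod => i _; rewrite exprn_ge0 //= ffunE.
rewrite -(bigA_distr_bigA (fun i (j : 'I_N) => a ^+ j)) /=.
rewrite -[X in _ ^+ X]card_ord -prodr_const; apply: ler_prod => i _.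
by rewrite sumr_ge0 ?sum_geometric_le // => j _; rewrite exprn_ge0.
Qed.

End MultiIndices.

(** * Termwise differentiation of power series with geometric bounds *)

Section PowerSeries.
Context {R : realType} (n : nat).
Implicit Types (h : 'rV[R]_n) (k : {ffun 'I_n -> nat}).

Lemma hpowZ (a : R) h k : hpow (a *: h) k = a ^+ mdeg k * hpow h k.
Proof.
rewrite /hpow /mdeg -prodrXr -big_split; apply: eq_bigr => i _.
by rewrite mxE exprMn.
Qed.

Lemma hpow_le (rho : R) h k : (forall i, `|h 0 i| <= rho) ->
  `|hpow h k| <= rho ^+ mdeg k.
Proof.
move=> hrho; rewrite normr_prod /mdeg -prodrXr; apply: ler_prod => i _.
by rewrite normr_ge0 normrX lerXn2r ?nnegrE // (le_trans _ (hrho i)).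
Qed.

Lemma taylor2_pow_le (rho y t : R) p : 0 < rho -> `|y| <= rho -> `|y + t| <= rho ->
  `|(y + t) ^+ p - y ^+ p - t * (p%:R * y ^+ p.-1)|
     <= t ^+ 2 * (4 * rho) ^+ p / rho ^+ 2.
Proof.
move=> rho0 yr ytr; elim: p => [|p IH].
  rewrite !expr0 subrr mul0r mulr0 subr0 normr0 mulr1.
  by rewrite mulr_ge0 ?sqr_ge0 // invr_ge0 sqr_ge0.
have -> : (y + t) ^+ p.+1 - y ^+ p.+1 - t * (p.+1%:R * y ^+ p) =
    (y + t) * ((y + t) ^+ p - y ^+ p - t * (p%:R * y ^+ p.-1)) +
    t ^+ 2 * (p%:R * y ^+ p.-1).
  by case: p {IH} => [|p] /=; rewrite ?exprS -?natr1; ring.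
apply: le_trans (ler_normD _ _) _; rewrite normrM [X in _ + X]normrM.
apply: (@le_trans _ _ (rho * (t ^+ 2 * (4 * rho) ^+ p / rho ^+ 2) +
    t ^+ 2 * (p%:R * rho ^+ p.-1))).
  apply: lerD; first exact: ler_pM.
  rewrite ger0_norm ?sqr_ge0 // ler_wpM2l ?sqr_ge0 // normrM normrX normr_nat.
  by rewrite ler_wpM2l // lerXn2r ?nnegrE // ltW.
have p4 : p%:R <= 3 * 4 ^+ p :> R.
  rewrite -natrX -natrM ler_nat; apply: leq_trans (leq_pmull _ _) => //.
  by rewrite ltnW // ltn_expl.
have -> : t ^+ 2 * (4 * rho) ^+ p.+1 / rho ^+ 2 =
    rho * (t ^+ 2 * (4 * rho) ^+ p / rho ^+ 2) +
    t ^+ 2 * (3 * 4 ^+ p * (rho ^+ p / rho)).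
  by rewrite !exprMn [4 ^+ p.+1]exprS [rho ^+ p.+1]exprS; field; rewrite gt_eqF.
rewrite lerD2l ler_wpM2l ?sqr_ge0 // {IH}; case: p p4 => [|p] p4.
  rewrite !mul0r; apply: mulr_ge0; first by rewrite mulr_ge0.
  by rewrite divr_ge0 // ltW.
by rewrite [X in X / rho]exprSr mulfK ?gt_eqF // ler_wpM2r // exprn_ge0 // ltW.
Qed.

Lemma taylor2_hpow_le (rho t : R) h k i : 0 < rho -> (forall j, `|h 0 j| <= rho) ->
  `|h 0 i + t| <= rho ->
  `|hpow (t *: delta_mx 0 i + h) k - hpow h k -
      t * ((k i)%:R * h 0 i ^+ (k i).-1 * \prod_(j | j != i) h 0 j ^+ k j)|
    <= t ^+ 2 * (4 * rho) ^+ mdeg k / rho ^+ 2.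
Proof.
move=> rho0 hrho htrho; rewrite /hpow (bigD1 i) //= [X in _ - X - _](bigD1 i) //=.
have -> : (t *: delta_mx 0 i + h) 0 i = h 0 i + t.
  by rewrite !mxE !eqxx mulr1 addrC.
have -> : \prod_(j | j != i) (t *: delta_mx 0 i + h) 0 j ^+ k j =
    \prod_(j | j != i) h 0 j ^+ k j.
  by apply: eq_bigr => j /negPf ji; rewrite !mxE ji andbF mulr0 add0r.
set P := \prod_(j | _) _.
rewrite [t * _]mulrA -!mulrBl normrM.
(* The weaker base [4 * rho] lets the exponents add up to [mdeg k]. *)
have P_le : `|P| <= (4 * rho) ^+ (\sum_(j | j != i) k j).
  rewrite normr_prod -prodrXr; apply: ler_prod => j _.
  rewrite normr_ge0 normrX lerXn2r ?nnegrE //.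
    by rewrite mulr_ge0 // ltW.
  by apply: le_trans (hrho j) _; lra.
rewrite (mdegD1 k i) exprD [t ^+ 2 * _]mulrA mulrAC; apply: ler_pM => //.
exact: taylor2_pow_le.
Qed.

Context {V : completeNormedModType R}.
Implicit Types a : {ffun 'I_n -> nat} -> V.

Definition pser a h : V := sum (fun k => hpow h k *: a k).
(** The coefficients of the partial derivative in direction [i]: that of $h^k$ comes from
    $h^{k+e_i}$. *)
Definition dcoef (i : 'I_n) a k : V := (k i).+1%:R *: a (mincr k i).
Definition geom_bounded a (M C : R) := forall k, `|a k| <= M * C ^+ mdeg k.

Lemma geom_bounded_ge0 a M C : geom_bounded a M C -> 0 <= M.
Proof.
move=> /(_ [ffun=> 0%N]); rewrite /mdeg big1 ?mulr1 => [|i _]; last by rewrite ffunE.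
exact: le_trans.
Qed.

Lemma geom_bounded_summable a M C rho h : 0 <= C -> geom_bounded a M C ->
  (forall i, `|h 0 i| <= rho) -> 0 <= rho -> rho * C < 1 ->
  summable (fun k => hpow h k *: a k).
Proof.
move=> C0 aMC hrho rho0 rhoC.
have M0 := geom_bounded_ge0 aMC.
apply: (@le_summable _ _ _ _ (fun k => M * (rho * C) ^+ mdeg k)) => [k|].
  rewrite normrZ exprMn mulrCA; apply: ler_pM => //; exact: hpow_le.
by apply: bounded_sumsZ => //; apply: bounded_sums_geometric; rewrite // mulr_ge0.
Qed.

(** The factor $k_i+1\le 2^{|k|}$ is absorbed by doubling the ratio, so the class of geometrically
    bounded coefficients is closed under differentiation. *)
Lemma dcoef_geom_bounded i a M C : 0 <= C -> geom_bounded a M C ->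
  geom_bounded (dcoef i a) (M * C) (2 * C).
Proof.
move=> C0 aMC k; rewrite /dcoef normrZ normr_nat.
have M0 := geom_bounded_ge0 aMC.
have k2 : (k i).+1%:R <= 2 ^+ mdeg k :> R.
  rewrite -natrX ler_nat; apply: leq_trans (ltn_expl (k i) (ltnSn 1)) _.
  by rewrite leq_exp2l // leq_mdeg.
apply: le_trans (ler_pM _ _ k2 (aMC _)) _ => //.
by rewrite mdeg_mincr exprS exprMn le_eqVlt; apply/orP; left; apply/eqP; ring.
Qed.

(** Term by term, the difference quotient departs from the expected derivative by at most
    $|t|\,M\rho^{-2}2^{-|k|}$, by the second-order Taylor bound; the sum over $k$ is a constant
    times $|t|$. *)
Lemma is_derive_pser a M C h i : 0 < C -> geom_bounded a M C ->
  (forall j, `|h 0 j| < (8 * C)^-1) ->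
  is_derive h (delta_mx 0 i) (pser a) (pser (dcoef i a) h).
Proof.
move=> C0 aMC hC; set rho := (8 * C)^-1; set v : 'rV[R]_n := delta_mx 0 i.
have rho0 : 0 < rho by rewrite invr_gt0 mulr_gt0.
have C'0 := ltW C0; have rho'0 := ltW rho0.
(* The choice of [rho]: the ratio [4 * rho * C] of the Taylor remainders becomes 1/2. *)
have rhoC : rho * C = 1 / 8 by rewrite /rho; field; rewrite gt_eqF.
have M0 := geom_bounded_ge0 aMC.
have hrho j : `|h 0 j| <= rho by rewrite ltW.
have pserE a' M' C' h' : 0 <= C' -> rho * C' < 1 -> geom_bounded a' M' C' ->
    (forall j, `|h' 0 j| <= rho) ->
    has_sum (fun k => hpow h' k *: a' k) (pser a' h').
  by move=> ? ? ? ?; apply/summable_has_sum/geom_bounded_summable; eauto.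
(* The derivative of term [k] before the index shift; it vanishes for $k_i=0$, that is, outside the
   image of [mincr]. *)
pose F k := ((k i)%:R * h 0 i ^+ (k i).-1 * \prod_(j | j != i) h 0 j ^+ k j) *: a k.
have sF : has_sum F (pser (dcoef i a) h).
  apply: (has_sum_inj (mincr_inj (i := i))) => [k hk|].
    rewrite /F; case: (posnP (k i)) => [->|ki]; first by rewrite !mul0r scale0r.
    have /eqP[] := hk [ffun j => (k j - (j == i))%N].
    by apply/ffunP => j; rewrite !ffunE; case: eqP => [->|]; rewrite ?subnK ?subn0 ?addn0.
  apply: (@eq_has_sum _ _ _ (fun k => hpow h k *: dcoef i a k)) => [k /=|]; last first.
    apply: (pserE _ (M * C) (2 * C)) => //; first by rewrite mulr_ge0.
      by rewrite mulrCA rhoC; lra.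
    exact: dcoef_geom_bounded.
  rewrite /F /dcoef scalerA /hpow (bigD1 i) //= ffunE eqxx addn1 /=.
  congr (_ *: _); rewrite mulrC mulrA; congr (_ * _ * _).
  by apply: eq_bigr => j /negPf ji; rewrite ffunE ji addn0.
have h2_ge0 : 0 <= 1 / 2 :> R by lra.
have h2_lt1 : 1 / 2 < 1 :> R by lra.
have [B hB] := bounded_sums_geometric n h2_ge0 h2_lt1.
have B0 : 0 <= B by have := hB fset0; rewrite big_seq_fset0.
pose K := M * B / rho ^+ 2.
have K0 : 0 <= K by rewrite divr_ge0 ?sqr_ge0 // mulr_ge0.
have key (t : R) : t != 0 -> `|h 0 i + t| <= rho ->
    `|pser (dcoef i a) h - t^-1 *: (pser a (t *: v + h) - pser a h)| <= `|t| * K.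
  move=> t0 ht; rewrite distrC.
  have htrho j : `|(t *: v + h) 0 j| <= rho.
    rewrite !mxE /=; case: eqP => [->|_]; last by rewrite mulr0 add0r.
    by rewrite mulr1 addrC.
  have s1 := pserE a M C (t *: v + h) C'0 _ aMC htrho.
  have s2 := pserE a M C h C'0 _ aMC hrho.
  have C1 : rho * C < 1 by rewrite rhoC; lra.
  have sQ := has_sumD (has_sumZ (a := t^-1) (has_sumB (s1 C1) (s2 C1))) (has_sumN sF).
  apply: (has_sum_norm_le sQ) => J.
  apply: (@le_trans _ _ (\sum_(k <- J) `|t| * (M / rho ^+ 2) * (1 / 2) ^+ mdeg k)).
    apply: ler_sum => k _.
    rewrite -scalerBl scalerA -scaleNr -scalerDl normrZ.
    set d := hpow (t *: v + h) k - hpow h k; set D := _ * \prod_(j | _) _.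
    have -> : t^-1 * d - D = t^-1 * (d - t * D) by field.
    rewrite normrM normfV.
    have h1 := taylor2_hpow_le k rho0 hrho ht.
    have t0' : 0 < `|t| by rewrite normr_gt0.
    apply: (@le_trans _ _ (`|t|^-1 * (t ^+ 2 * (4 * rho) ^+ mdeg k / rho ^+ 2)
        * (M * C ^+ mdeg k))).
      by apply: ler_pM => //; rewrite ler_wpM2l // invr_ge0.
    have -> : (1 / 2) ^+ mdeg k = (4 * rho) ^+ mdeg k * C ^+ mdeg k.
      by rewrite -exprMn -mulrA rhoC; congr (_ ^+ _); field.
    rewrite -(real_normK (num_real t)) le_eqVlt; apply/orP; left; apply/eqP.
    by field; rewrite !gt_eqF.
  rewrite -mulr_sumr /K -mulrA ler_wpM2l // [leRHS]mulrAC ler_wpM2l //.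
  by rewrite divr_ge0 // sqr_ge0.
suff cv : t^-1 *: (pser a (t *: v + h) - pser a h) @[t --> 0^'] -->
    pser (dcoef i a) h.
  by split; [apply/cvg_ex; exists (pser (dcoef i a) h)|exact: cvg_lim].
apply/cvgrPdist_le => e e0.
(* The first bound keeps the displaced point in the polydisc of radius [rho], the second makes the
   error [|t| K] at most [e]; [K + 1] avoids a division by 0. *)
pose del := Num.min (rho - `|h 0 i|) (e / (K + 1)).
have del0 : 0 < del.
  rewrite lt_min subr_gt0 hC divr_gt0 //; first by apply: ltr_wpDl.
exists del => //= t; rewrite /ball_ /= sub0r normrN lt_min => /andP[t1 t2] t0.
apply: le_trans (key t t0 _) _.
  by apply: le_trans (ler_normD _ _) _; lra.
apply: (@le_trans _ _ (e / (K + 1) * (K + 1))).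
  by apply: ler_pM => //; [exact: ltW|rewrite lerDl].
by rewrite divfK // gt_eqF // ltr_wpDl.
Qed.

Lemma pser0 a : pser a 0 = a [ffun=> 0%N].
Proof.
apply: has_sum_sum; apply/has_sumP => e e0; exists [fset [ffun=> 0%N]]%fset => J hJ.
rewrite (big_fsetD1 [ffun=> 0%N]) /=; last first.
  by apply: (fsubsetP hJ); rewrite inE.
rewrite /hpow big1 => [|i _]; last by rewrite ffunE expr0.
rewrite scale1r opprD addrA subrr sub0r normrN big1_seq ?normr0 ?ltW // => k /andP[_].
rewrite !inE => /andP[k0 _].
have /existsP[i ki] : [exists i, k i != 0%N].
  apply: contraNT k0; rewrite negb_exists => /forallP h; apply/eqP/ffunP => i.
  by rewrite ffunE; apply/eqP; rewrite -[_ == _]negbK.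
by rewrite (bigD1 i) //= mxE expr0n (negPf ki) mul0r scale0r.
Qed.

Lemma coord_lt_near (r : R) h : 0 < r -> (forall j, `|h 0 j| < r) ->
  \forall x \near h, forall j, `|(x : 'rV[R]_n) 0 j| < r.
Proof.
move=> r0 hr; apply/nbhs_normP; exists (\big[Num.min/r]_j (r - `|h 0 j|)) => /=.
  by apply/bigmin_gtP; split => // j _; rewrite subr_gt0.
move=> x hx j.
have le_coord : `|x 0 j - h 0 j| <= `|h - x|.
  rewrite distrC [leRHS]/Num.Def.normr /= mx_normrE.
  by apply/bigmax_geP; right => /=; exists (0, j); rewrite //= !mxE.
have /(le_lt_trans le_coord) : `|h - x| < r - `|h 0 j|.
  by apply: lt_le_trans hx _; exact: bigmin_le_cond.
by have := ler_normD (x 0 j - h 0 j) (h 0 j); rewrite subrK; lra.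
Qed.

(** Differentiating once more requires the previous derivative on a neighborhood, not only at 0. The
    induction therefore carries an explicit cube on which the equality holds, and each derivative
    halves its side. *)
Lemma partials_pser a M C (s : seq 'I_n) : 0 < C -> geom_bounded a M C ->
  partials_exist s (pser a) 0 /\
  (\forall h \near (0 : 'rV[R]_n), partials s (pser a) h = pser (foldr dcoef a s) h).
Proof.
move=> C0 aMC.
suff [M' [C' [C'0 aMC' h1 h2]]] : exists M' C', [/\ 0 < C',
    geom_bounded (foldr dcoef a s) M' C', partials_exist s (pser a) 0 &
    forall h, (forall j, `|h 0 j| < (8 * C')^-1) ->
      partials s (pser a) h = pser (foldr dcoef a s) h].
  split => //; have r0 : 0 < (8 * C')^-1 by rewrite invr_gt0 mulr_gt0.
  by apply: (filterS h2); apply: coord_lt_near => // j; rewrite mxE normr0.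
elim: s => [|i s [M' [C' [C'0 aMC' h1 h2]]]]; first by exists M, C.
have r0 : 0 < (8 * C')^-1 by rewrite invr_gt0 mulr_gt0.
have C'2 : (8 * (2 * C'))^-1 <= (8 * C')^-1.
  by rewrite lef_pV2 ?posrE ?mulr_gt0 // ler_pM2l //; lra.
have h2' h : (forall j, `|h 0 j| < (8 * C')^-1) ->
    is_derive h (delta_mx 0 i) (partials s (pser a)) (pser (foldr dcoef a (i :: s)) h).
  move=> hC'; apply: (near_eq_is_derive (f := pser (foldr dcoef a s))).
    by apply: filterS (coord_lt_near r0 hC') => x /h2.
  exact: is_derive_pser aMC' hC'.
exists (M' * C'), (2 * C'); split; first by rewrite mulr_gt0.
- by apply: dcoef_geom_bounded => //; exact: ltW.
- split=> //.
  have : \forall x \near (0 : 'rV[R]_n), forall j, `|(x : 'rV[R]_n) 0 j| < (8 * C')^-1.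
    by apply: coord_lt_near => // j; rewrite mxE normr0.
  by apply: filterS => h hC'; case: (h2' h hC').
- move=> h hC'.
  have hC'' j : `|h 0 j| < (8 * C')^-1 by exact: lt_le_trans (hC' j) C'2.
  by have [_ <-] := h2' h hC''.
Qed.

(** Weighted by the factorial of the multi-index, the factors $k_i+1$ collected by [dcoef]
    telescope; at [k = 0] this is Taylor's formula for the coefficients. *)
Lemma mfact_dcoef a (s : seq 'I_n) k :
  (mfact k)%:R *: foldr dcoef a s k =
  (mfact [ffun i => (k i + count_mem i s)%N])%:R
    *: a [ffun i => (k i + count_mem i s)%N].
Proof.
elim: s k => [|i s IH] k /=.
  by have -> : [ffun i => (k i + 0)%N] = k by apply/ffunP => i; rewrite ffunE addn0.
rewrite /dcoef scalerA mulrC -natrM -mfact_mincr IH.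
have -> // : [ffun j => (mincr k i j + count_mem j s)%N] =
  [ffun j => (k j + ((i == j) + count_mem j s))%N].
by apply/ffunP => j; rewrite !ffunE addnA eq_sym.
Qed.

Lemma count_directions k i : count_mem i (directions k) = k i.
Proof.
rewrite /directions count_flatten -map_comp sumnE big_map.
rewrite big_enum /= (bigD1 i) //= count_nseq /= eqxx mul1n big1 ?addn0 // => j ji.
by rewrite count_nseq /= (negPf ji).
Qed.

End PowerSeries.

(** * Norms on Clifford algebras *)

Section Coefficients.
Context {R : realType} {c : clifford_kind}.
Implicit Types z : coeff R c.

(** Real coordinates common to both kinds of scalars, with imaginary part 0 in the real case;
    completeness of the algebra is reduced through them to that of [R]. *)
Definition coeff_re : coeff R c -> R :=
  match c as c' return coeff R c' -> R with
  | RealClifford => fun a => a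
  | ComplexClifford => fun w => complex.Re w
  end.

Definition coeff_im : coeff R c -> R :=
  match c as c' return coeff R c' -> R with
  | RealClifford => fun=> 0
  | ComplexClifford => fun w => complex.Im w
  end.

Definition coeff_mk (a b : R) : coeff R c :=
  match c as c' return coeff R c' with
  | RealClifford => a
  | ComplexClifford => Complex a b
  end.

Lemma coeff_re_normB z z' : `|coeff_re z - coeff_re z'| <= coeff_norm (z - z').
Proof.
rewrite /coeff_re; case: c z z' => //= -[a b] [a' b'] /=.
by rewrite -[leLHS]sqrtr_sqr ler_wsqrtr // lerDl sqr_ge0.
Qed.

Lemma coeff_im_normB z z' : `|coeff_im z - coeff_im z'| <= coeff_norm (z - z').
Proof.
rewrite /coeff_im; case: c z z' => [a b|[a b] [a' b']] /=.
  by rewrite subrr normr0.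
by rewrite -[leLHS]sqrtr_sqr ler_wsqrtr // lerDr sqr_ge0.
Qed.

Lemma coeff_norm_mkB z (a b : R) :
  coeff_norm (z - coeff_mk a b) <= `|coeff_re z - a| + `|coeff_im z - b|.
Proof.
rewrite /coeff_im /coeff_re /coeff_mk; case: c z => [z|[x y]] /=; first by rewrite lerDl.
set u := x - a; set v := y - b.
have uv0 : 0 <= `|u| + `|v| by rewrite addr_ge0.
rewrite -[leRHS]ger0_norm // -(sqrtr_sqr (`|u| + `|v|)) ler_wsqrtr //.
by rewrite [leRHS]sqrrD !real_normK ?num_real // addrAC lerDl mulrn_wge0 // mulr_ge0 //.
Qed.

Lemma coeff_normM z z' : coeff_norm (z * z') = coeff_norm z * coeff_norm z'.
Proof.
case: c z z' => [|] z z' /=; first exact: normrM.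
rewrite -sqrtrM ?addr_ge0 ?sqr_ge0 //; case: z z' => [a b] [a' b'] /=.
by congr Num.sqrt; ring.
Qed.

Lemma coeff_norm0 : coeff_norm (0 : coeff R c) = 0.
Proof.
by rewrite -(mul0r (0 : coeff R c)) -(rmorph0 (coeff_of_real c)) coeff_normZ normr0 mul0r.
Qed.

Lemma coeff_norm1 : coeff_norm (1 : coeff R c) = 1.
Proof.
by case: c => /=; rewrite ?normr1 // expr1n expr0n addr0 sqrtr1.
Qed.

Lemma coeff_norm_sum (T : Type) (r : seq T) (P : pred T) (F : T -> coeff R c) :
  coeff_norm (\sum_(i <- r | P i) F i) <= \sum_(i <- r | P i) coeff_norm (F i).
Proof.
elim/big_rec2: _ => [|i y z _ IH]; first by rewrite coeff_norm0.
by apply: le_trans (coeff_normD _ _) _; rewrite lerD2l.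
Qed.

Lemma coeff_norm_sign p z : coeff_norm ((-1) ^+ p * z) = coeff_norm z.
Proof.
have -> : (-1) ^+ p * z = coeff_of_real c ((-1) ^+ p) * z.
  by rewrite rmorphXn rmorphN1.
by rewrite coeff_normZ normrX normrN1 expr1n mul1r.
Qed.

End Coefficients.

Section CliffordNorm.
Context {R : realType} {c : clifford_kind}.

Lemma cl_normE m (x : clifford R c m) : `|x| = \sum_A coeff_norm (x A).
Proof. by []. Qed.

Lemma coeff_norm_le_norm m (x : clifford R c m) A : coeff_norm (x A) <= `|x|.
Proof.
by rewrite cl_normE (bigD1 A) //= lerDl sumr_ge0 // => B _; exact: coeff_norm_ge0.
Qed.

(** Each real coordinate is 1-Lipschitz, so it maps a Cauchy filter to a convergent one, and the
    limit is assembled from finitely many coordinates. *)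
Lemma cl_complete m (F : set_system (clifford R c m)) :
  ProperFilter F -> cauchy F -> cvg F.
Proof.
move=> FF /cauchyP Fc; apply/cvg_ex.
have cvg_coord (phi : clifford R c m -> R) :
    (forall x y, `|phi x - phi y| <= `|x - y|) -> {l : R | phi x @[x --> F] --> l}.
  move=> phi_le; exists (lim (phi x @[x --> F])); apply: R_complete.
  apply: cauchy_exP => e e0.
  have [x Fx] := Fc e e0; exists (phi x).
  suff : F (phi @^-1` ball (phi x) e) by [].
  apply: filterS Fx => y /=.
  by rewrite -!ball_normE /=; apply: le_lt_trans.
have re_cvg A : {l : R | (fun x : clifford R c m => coeff_re (x A)) @ F --> l}.
  apply: cvg_coord => x y; apply: le_trans (coeff_re_normB _ _) _.
  by have := coeff_norm_le_norm (x - y) A; rewrite !ffunE.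
have im_cvg A : {l : R | (fun x : clifford R c m => coeff_im (x A)) @ F --> l}.
  apply: cvg_coord => x y; apply: le_trans (coeff_im_normB _ _) _.
  by have := coeff_norm_le_norm (x - y) A; rewrite !ffunE.
pose re A := sval (re_cvg A); pose im A := sval (im_cvg A).
have hre A : (fun x : clifford R c m => coeff_re (x A)) @ F --> re A.
  by rewrite /re; case: (re_cvg A).
have him A : (fun x : clifford R c m => coeff_im (x A)) @ F --> im A.
  by rewrite /im; case: (im_cvg A).
exists [ffun A => coeff_mk (re A) (im A)].
apply/cvgrPdist_le => e e0.
(* Each blade carries two real coordinates. *)
pose d := e / (2 * #|{set 'I_m}|%:R).
have N0 : 0 < #|{set 'I_m}|%:R :> R by rewrite ltr0n; apply/card_gt0P; exists finset.set0.
have d0 : 0 < d by rewrite divr_gt0 // mulr_gt0.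
have : \forall x \near F, forall A,
    `|coeff_re ((x : clifford R c m) A) - re A| + `|coeff_im (x A) - im A| <= d + d.
  apply: filter_forall => A.
  have /cvgrPdist_le/(_ _ d0) h1 := hre A.
  have /cvgrPdist_le/(_ _ d0) h2 := him A.
  apply: filterS (filterI h1 h2) => x [/= hx1 hx2].
  by apply: lerD; rewrite distrC.
apply: filterS => x hx; rewrite distrC cl_normE.
have -> : e = \sum_(A : {set 'I_m}) (d + d).
  by rewrite sumr_const -mulr_natl /d; field; rewrite gt_eqF.
apply: ler_sum => A _; apply: le_trans (hx A).
by rewrite !ffunE; exact: coeff_norm_mkB.
Qed.

HB.instance Definition _ m := Uniform_isComplete.Build (clifford R c m) (@cl_complete m).

(** Signs leave the norm unchanged, and each pair of blades contributes to exactly one blade of the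
    product. *)
Lemma cl_normM m (x y : clifford R c m) : `|x * y| <= `|x| * `|y|.
Proof.
rewrite !cl_normE.
apply: (@le_trans _ _ (\sum_C \sum_A \sum_(B | symd A B == C)
    coeff_norm (x A) * coeff_norm (y B))).
  apply: ler_sum => C _; rewrite ffunE.
  apply: le_trans (coeff_norm_sum _ _ _) _; apply: ler_sum => A _.
  apply: le_trans (coeff_norm_sum _ _ _) _; apply: ler_sum => B _.
  by rewrite coeff_norm_sign coeff_normM.
rewrite exchange_big mulr_suml; apply: ler_sum => A _ /=.
under eq_bigr do rewrite big_mkcond /=.
rewrite exchange_big mulr_sumr; apply: ler_sum => B _ /=.
by rewrite -big_mkcond (big_pred1 (symd A B)) // => C; rewrite /= eq_sym.
Qed.

Lemma cl_norm1 m : `|1 : clifford R c m| = 1.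
Proof.
rewrite cl_normE (bigD1 finset.set0) //= big1 => [|A /negPf A0].
  by rewrite ffunE eqxx coeff_norm1 addr0.
by rewrite ffunE A0 coeff_norm0.
Qed.

Lemma cl_normX m (x : clifford R c m) p : `|x ^+ p| <= `|x| ^+ p.
Proof.
elim: p => [|p IH]; first by rewrite !expr0 cl_norm1.
by rewrite !exprS; apply: le_trans (cl_normM _ _) _; rewrite ler_wpM2l.
Qed.

Lemma cl_norm_alg m (a : R) : `|a%:A : clifford R c m| = `|a|.
Proof. by rewrite normrZ cl_norm1 mulr1. Qed.

Lemma cl_norm_blade m A : `|blade R c A : clifford R c m| = 1.
Proof.
rewrite cl_normE (bigD1 A) //= big1 => [|B /negPf BA].
  by rewrite ffunE eqxx coeff_norm1 addr0.
by rewrite ffunE BA coeff_norm0.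
Qed.

Lemma cl_norm_gen m j : `|cl_gen R c m j| <= 1.
Proof.
rewrite /cl_gen; case: (pickP (fun i : 'I_m => i.+1 == j)) => [i /eqP <-|h].
  by rewrite -/(cl_gen R c m i.+1) cl_genE cl_norm_blade.
by rewrite big_pred0 // normr0.
Qed.

Lemma cl_norm_incl n m (x : clifford R c n) : `|cl_incl m x| <= `|x|.
Proof.
rewrite !cl_normE.
apply: (@le_trans _ _ (\sum_B \sum_(A | relabel m A == B) coeff_norm (x A))).
  by apply: ler_sum => B _; rewrite ffunE; exact: coeff_norm_sum.
under eq_bigr do rewrite big_mkcond /=.
rewrite exchange_big; apply: ler_sum => A _ /=.
by rewrite -big_mkcond (big_pred1 (relabel m A)) // => B; rewrite /= eq_sym.
Qed.

Lemma relabel_relabel n r m (A : {set 'I_n}) : (n <= r)%N -> (r <= m)%N ->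
  relabel m (relabel r A) = relabel m A.
Proof.
move=> nr rm; rewrite (relabelE nr) (relabelE rm) (relabelE (leq_trans nr rm)).
by rewrite -imset_comp; apply: eq_imset => i; exact: val_inj.
Qed.

Lemma cl_incl_incl n r m (x : clifford R c n) : (n <= r)%N -> (r <= m)%N ->
  cl_incl m (cl_incl r x) = cl_incl m x.
Proof.
move=> nr rm; apply/ffunP => C; rewrite [LHS]ffunE [RHS]ffunE.
under eq_bigr do rewrite ffunE.
rewrite (exchange_big_dep predT) //= big_mkcond [RHS]big_mkcond /=.
apply: eq_bigr => A _; rewrite -(relabel_relabel A nr rm).
case: eqP => hC; last by rewrite big1 // => B /andP[/eqP hB /eqP AB]; case: hC; rewrite AB.
rewrite (bigD1 (relabel r A)) /=; last by rewrite eqxx hC eqxx.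
by rewrite big1 ?addr0 // => B /andP[/andP[_ /eqP <-]]; rewrite eqxx.
Qed.

Lemma cl_incl_id m (x : clifford R c m) : cl_incl m x = x.
Proof.
apply/ffunP => C; rewrite ffunE (bigD1 C) /=; last first.
  by rewrite (relabelE (leqnn m)); apply/eqP/setP => i;
     apply/imsetP/idP => [[j jC ->]|iC]; [rewrite (_ : widen_ord _ j = j) //; exact: val_inj|
     exists i => //; exact: val_inj].
rewrite big1 ?addr0 // => B /andP[/eqP h].
move=> /eqP[]; rewrite -h (relabelE (leqnn m)); apply/setP => i.
by apply/idP/imsetP => [iC|[j jC ->]]; [exists i => //; exact: val_inj|
   rewrite (_ : widen_ord _ j = j) //; exact: val_inj].
Qed.

Lemma cl_inclX n m (x : clifford R c n) p : (n <= m)%N ->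
  cl_incl m (x ^+ p) = cl_incl m x ^+ p.
Proof.
move=> nm; elim: p => [|p IH]; first by rewrite !expr0 cl_incl1.
by rewrite !exprS cl_inclM // IH.
Qed.

Lemma cl_incl_is_linear n m : linear (@cl_incl R c n m).
Proof. by move=> a x y; rewrite cl_inclD cl_inclZ. Qed.

HB.instance Definition _ n m := GRing.isLinear.Build R _ _ _ (@cl_incl R c n m)
  (@cl_incl_is_linear n m).

End CliffordNorm.

(** * Gegenbauer polynomials *)

Section Majorant.
Context {R : realType}.
Implicit Types (a b q : R) (n : nat).

(* The coefficients of (1 - h) ^ (- a). *)
Definition rising_coef a n : R := \prod_(i < n) ((i%:R + a) / i.+1%:R).

Lemma rising_coef0 a : rising_coef a 0 = 1.
Proof. by rewrite /rising_coef big_ord0. Qed.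

Lemma rising_coefS a n : n.+1%:R * rising_coef a n.+1 = (n%:R + a) * rising_coef a n.
Proof.
rewrite /rising_coef big_ord_recr /= mulrCA mulrC; congr (_ * _).
by rewrite mulrC divfK // pnatr_eq0.
Qed.

Lemma rising_coef_ge0 a n : 0 <= a -> 0 <= rising_coef a n.
Proof.
by move=> a0; apply: prodr_ge0 => i _; rewrite divr_ge0 // addr_ge0.
Qed.

(** Coefficients of $\frac{d}{dh}(1-h)^{-a}=a(1-h)^{-a-1}$. *)
Lemma rising_coef_diffs a n :
  n.+1%:R * rising_coef a n.+1 = a * rising_coef (a + 1) n.
Proof.
elim: n => [|n IH]; first by rewrite rising_coefS !rising_coef0 add0r.
apply: (@mulfI _ n.+1%:R); first by rewrite pnatr_eq0.
rewrite rising_coefS mulrCA IH [RHS]mulrCA rising_coefS -natr1; ring.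
Qed.

(** Coefficients of $h\frac{d}{dh}(1-h)^{-a}=a\frac{h}{1-h}(1-h)^{-a}$, the extreme case of the
    convolution identity [gegen_conv]. *)
Lemma rising_coef_sum a n :
  n%:R * rising_coef a n = a * \sum_(k < n) rising_coef a k.
Proof.
elim: n => [|n IH]; first by rewrite mul0r big_ord0 mulr0.
by rewrite rising_coefS big_ord_recr /= mulrDr -IH; ring.
Qed.

(** The ratio $(n+a)/(n+1)$ of consecutive coefficients is at most [q] as soon as $n>a/(q-1)$; the
    sum of the earlier coefficients serves as [M]. *)
Lemma rising_coef_geometric a q : 0 <= a -> 1 < q ->
  exists2 M, 0 <= M & forall n, rising_coef a n <= M * q ^+ n.
Proof.
move=> a0 q1; have q0 : 0 < q by apply: lt_trans q1.
pose N := Num.truncn (a / (q - 1)).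
have hN n : (N < n)%N -> n%:R + a <= q * n.+1%:R.
  move=> Nn; have : a / (q - 1) <= n%:R.
    apply: ltW; apply: lt_le_trans (truncnS_gt _) _; by rewrite ler_nat.
  rewrite ler_pdivrMr ?subr_gt0 // -natr1; nra.
exists (\sum_(k < N.+2) rising_coef a k).
  by apply: sumr_ge0 => k _; exact: rising_coef_ge0.
elim=> [|n IH].
  rewrite expr0 mulr1 (bigD1 ord0) //= lerDl sumr_ge0 // => k _.
  exact: rising_coef_ge0.
have [nN|Nn] := ltnP n N.+1.
  apply: (@le_trans _ _ (\sum_(k < N.+2) rising_coef a k)).
    rewrite (bigD1 (Ordinal (nN : n.+1 < N.+2)%N)) //= lerDl sumr_ge0 // => k _.
    exact: rising_coef_ge0.
  apply: ler_peMr; last by rewrite exprn_ege1 // ltW.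
  by apply: sumr_ge0 => k _; exact: rising_coef_ge0.
rewrite -(ler_pM2l (ltr0Sn R n)) rising_coefS.
apply: le_trans (ler_pM _ _ (hN n Nn) IH) _; rewrite ?addr_ge0 ?rising_coef_ge0 //.
by rewrite exprS le_eqVlt; apply/orP; left; apply/eqP; ring.
Qed.

Lemma is_cvg_pseries_rising (f : R^nat) a (C x : R) : 0 <= a -> 0 <= C -> `|x| < 1 ->
  (forall n, `|f n| <= C * rising_coef a n) -> cvgn (pseries f x).
Proof.
move=> a0 C0 x1 hf.
(* [1 / q] is the midpoint of [|x|] and 1, so that both [1 < q] and [q |x| < 1]. *)
pose q := 2 / (1 + `|x|); have x0 := normr_ge0 x.
have q1 : 1 < q by rewrite /q ltr_pdivlMr; lra.
have qx : q * `|x| < 1 by rewrite /q mulrAC ltr_pdivrMr; lra.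
have q0 : 0 <= q by lra.
have [M M0 hM] := rising_coef_geometric a0 q1.
apply: normed_cvg; apply: (@series_le_cvg _ _ (geometric (C * M) (q * `|x|))).
- by move=> n; rewrite normr_ge0.
- by move=> n /=; rewrite mulr_ge0 ?exprn_ge0 // mulr_ge0.
- move=> n /=; rewrite normrM normrX exprMn mulrA ler_wpM2r ?exprn_ge0 //.
  by apply: le_trans (hf n) _; rewrite -mulrA ler_wpM2l.
- by apply: is_cvg_geometric_series; rewrite ger0_norm // mulr_ge0.
Qed.

End Majorant.

(** * Recurrence, comparison with Chebyshev polynomials, and differential equation *)

Section GegenbauerPolynomials.
Context {R : realType} (nu : R).

(* The pair (C_n, C_(n+1)). *)
Fixpoint gegen_pair (n : nat) : {poly R} * {poly R} :=
  if n is n'.+1 then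
    let: (p, q) := gegen_pair n' in
    (q, n'.+2%:R^-1 *: ((2 * (n'.+1%:R + nu)) *: ('X * q) - (n'%:R + 2 * nu) *: p))
  else (1, (2 * nu) *: 'X).

Definition gegen (n : nat) : {poly R} := (gegen_pair n).1.

Lemma gegen0 t : (gegen 0).[t] = 1.
Proof. by rewrite /gegen /= hornerE. Qed.

Lemma gegen1 t : (gegen 1).[t] = 2 * nu * t.
Proof. by rewrite /gegen /= !hornerE. Qed.

Lemma gegen_rec n t : n.+2%:R * (gegen n.+2).[t] =
  2 * t * (n.+1%:R + nu) * (gegen n.+1).[t] - (n%:R + 2 * nu) * (gegen n).[t].
Proof.
rewrite /gegen /=; case: (gegen_pair n) => p q /=.
by rewrite !hornerE /=; field; rewrite -?natr1 lt0r_neq0 //; have := ler0n R n; lra.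
Qed.

Hypothesis nu_gt0 : 0 < nu.

Section Point.
Variable t : R.
Hypothesis t_le1 : `|t| <= 1.

(* (cos (n theta), sin (n theta) / sin theta) for t = cos theta *)
Fixpoint cheb_pair (n : nat) : R * R :=
  if n is n'.+1 then
    let: (p, q) := cheb_pair n' in (t * p - (1 - t ^+ 2) * q, p + t * q)
  else (1, 0).

Definition cheb n := (cheb_pair n).1.

Lemma cheb_rec n : cheb n.+2 = 2 * t * cheb n.+1 - cheb n.
Proof. by rewrite /cheb /=; case: (cheb_pair n) => p q /=; ring. Qed.

(** The identity $\cos^2 n\theta+\sin^2 n\theta=1$ in algebraic form, an invariant of the recursion
    of [cheb_pair]. *)
Lemma cheb_norm_le1 n : `|cheb n| <= 1.
Proof.
have h : (cheb_pair n).1 ^+ 2 + (1 - t ^+ 2) * (cheb_pair n).2 ^+ 2 = 1.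
  elim: n => [|n]; first by rewrite /= expr1n expr0n mulr0 addr0.
  by rewrite /=; case: (cheb_pair n) => p q /= IH; rewrite -[RHS]IH; ring.
have t2 : 0 <= 1 - t ^+ 2 by rewrite subr_ge0 -real_normK ?num_real // expr_le1.
rewrite -[leLHS]sqrtr_sqr -[leRHS]sqrtr1 ler_wsqrtr // /cheb.
by have := mulr_ge0 t2 (sqr_ge0 (cheb_pair n).2); lra.
Qed.

(** The coefficient of $h^{n-1}$ in the product of $\sum_n T_{n+1}h^n$ and the generating function
    of the [gegen]. *)
Let conv n : R := \sum_(k < n) cheb k.+1 * (gegen (n - k.+1)).[t].

Lemma conv_rec n : conv n.+2 =
  2 * t * conv n.+1 - conv n + t * (gegen n.+1).[t] - (gegen n).[t].
Proof.
rewrite /conv big_ord_recl big_ord_recl [X in 2 * t * X]big_ord_recl /=.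
rewrite /bump /= !subSS !subn0.
have -> : \sum_(i < n) cheb (1 + (1 + i)).+1 * (gegen (n.+2 - (1 + (1 + i)).+1)).[t] =
    2 * t * (\sum_(i < n) cheb (1 + i).+1 * (gegen (n.+1 - (1 + i).+1)).[t]) -
    \sum_(k < n) cheb k.+1 * (gegen (n - k.+1)).[t].
  rewrite mulr_sumr -sumrB; apply: eq_bigr => i _.
  by rewrite !add1n !subSS cheb_rec; ring.
rewrite cheb_rec /cheb /=; ring.
Qed.

(** This is the logarithmic derivative, read on coefficients. It is derived from the two three-term
    recurrences alone, so the bound on [gegen] is available before any convergence is known. *)
Lemma gegen_conv n : n%:R * (gegen n).[t] = 2 * nu * conv n.
Proof.
elim/ltn_ind: n => -[|[|n]] IH.
- by rewrite /conv big_ord0 mul0r mulr0.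
- by rewrite /conv big_ord1 gegen0 gegen1 /cheb /=; ring.
rewrite gegen_rec conv_rec.
have h2 := IH n (leqW (ltnSn n)); have h1 := IH n.+1 (ltnSn _).
transitivity (2 * t * (n.+1%:R * (gegen n.+1).[t]) + 2 * t * nu * (gegen n.+1).[t]
  - n%:R * (gegen n).[t] - 2 * nu * (gegen n).[t]); first by ring.
by rewrite h1 h2; ring.
Qed.

(** Strong induction comparing [gegen_conv] with [rising_coef_sum]: the two recursions differ by the
    weights [cheb], of absolute value at most 1. *)
Lemma gegen_norm_le n : `|(gegen n).[t]| <= rising_coef (2 * nu) n.
Proof.
elim/ltn_ind: n => -[|n] IH; first by rewrite gegen0 normr1 rising_coef0.
rewrite -(ler_pM2l (ltr0Sn R n)) rising_coef_sum.
have -> : n.+1%:R * `|(gegen n.+1).[t]| = `|n.+1%:R * (gegen n.+1).[t]|.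
  by rewrite normrM normr_nat.
rewrite gegen_conv normrM ger0_norm; last by rewrite mulr_ge0 // ltW.
rewrite ler_wpM2l //; first by rewrite mulr_ge0 // ltW.
apply: le_trans (ler_norm_sum _ _ _) _.
rewrite [leRHS](reindex_inj rev_ord_inj) /=; apply: ler_sum => k _.
rewrite normrM -[leRHS]mul1r; apply: ler_pM => //; first exact: cheb_norm_le1.
by apply: IH; rewrite subSS ltnS leq_subr.
Qed.

Section Generating.
Local Notation C := (fun n => (gegen n).[t]).

Lemma gegen_quad_gt0 x : `|x| < 1 -> 0 < 1 - 2 * t * x + x ^+ 2.
Proof.
move=> x1.
have -> : 1 - 2 * t * x + x ^+ 2 = (1 - t * x) ^+ 2 + x ^+ 2 * (1 - t ^+ 2) by ring.
have tx : 0 < 1 - t * x.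
  rewrite subr_gt0 (le_lt_trans (ler_norm _)) // normrM.
  by apply: le_lt_trans x1; rewrite ler_piMl.
apply: ltr_pwDl; first by rewrite exprn_gt0.
by rewrite mulr_ge0 ?sqr_ge0 // subr_ge0 -real_normK ?num_real // expr_le1.
Qed.

(** Bounds for the first and second formal derivatives serve [pseries_snd_diffs], which asks for
    convergence of the series and of both. *)
Lemma gegen_diffs_norm_le n :
  `|pseries_diffs C n| <= 2 * nu * rising_coef (2 * nu + 1) n.
Proof.
rewrite /pseries_diffs normrM normr_nat -rising_coef_diffs ler_wpM2l //.
exact: gegen_norm_le.
Qed.

Lemma gegen_diffs2_norm_le n : `|pseries_diffs (pseries_diffs C) n| <=
  2 * nu * (2 * nu + 1) * rising_coef (2 * nu + 1 + 1) n.
Proof.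
rewrite {1}/pseries_diffs normrM normr_nat -mulrA -rising_coef_diffs mulrCA.
by rewrite ler_wpM2l // gegen_diffs_norm_le.
Qed.

Let nu2_ge0 : 0 <= 2 * nu. Proof. by rewrite mulr_ge0 // ltW. Qed.

Lemma is_cvg_pseries_gegen x : `|x| < 1 -> cvgn (pseries C x).
Proof.
move=> x1; apply: (is_cvg_pseries_rising nu2_ge0 ler01 x1) => n.
by rewrite mul1r gegen_norm_le.
Qed.

Lemma is_cvg_pseries_gegen_diffs x : `|x| < 1 -> cvgn (pseries (pseries_diffs C) x).
Proof.
move=> x1; apply: (is_cvg_pseries_rising _ nu2_ge0 x1 gegen_diffs_norm_le).
exact: addr_ge0.
Qed.

Lemma is_cvg_pseries_gegen_diffs2 x : `|x| < 1 ->
  cvgn (pseries (pseries_diffs (pseries_diffs C)) x).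
Proof.
move=> x1; apply: (is_cvg_pseries_rising _ _ x1 gegen_diffs2_norm_le).
  by rewrite !addr_ge0.
by rewrite mulr_ge0 // addr_ge0.
Qed.

Lemma is_derive_pseries_gegen (x : R) : `|x| < 1 ->
  is_derive x (1 : R) (fun y : R => limn (pseries C y)) (limn (pseries (pseries_diffs C) x)).
Proof.
(* A radius strictly between [|x|] and 1, at which all three series converge. *)
move=> x1; have K1 : `|(1 + `|x|) / 2| < 1.
  by rewrite ger0_norm ?divr_ge0 ?addr_ge0 //; lra.
apply: (pseries_snd_diffs (is_cvg_pseries_gegen K1) (is_cvg_pseries_gegen_diffs K1)
  (is_cvg_pseries_gegen_diffs2 K1)).
by rewrite [ltRHS]ger0_norm ?divr_ge0 ?addr_ge0 //; lra.
Qed.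

(** With $G$ the generating function and $q$ the quadratic factor, these are the partial sums of
    $qG'-2\nu(t-x)G$: the three-term recurrence cancels everything but boundary terms. *)
Lemma gegen_ode_partial x n :
  (1 - 2 * t * x + x ^+ 2) * pseries (pseries_diffs C) x n
    - 2 * nu * (t - x) * pseries C x n =
  x ^+ n * (2 * nu * t * C n - n.+1%:R * C n.+1) + x ^+ n.+1 * (n%:R * C n).
Proof.
rewrite /pseries /series /=; elim: n => [|n IH].
  by rewrite !big_nil gegen0 gegen1 expr0; ring.
have distr (a b p q u v : R) :
    a * (p + u) - b * (q + v) = (a * p - b * q) + (a * u - b * v) by ring.
rewrite !big_nat_recr //= distr IH gegen_rec /pseries_diffs !exprS -natr1; ring.
Qed.

Lemma gegen_ode x : `|x| < 1 ->
  (1 - 2 * t * x + x ^+ 2) * limn (pseries (pseries_diffs C) x) =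
  2 * nu * (t - x) * limn (pseries C x).
Proof.
move=> x1; have c0 := is_cvg_pseries_gegen x1; have c1 := is_cvg_pseries_gegen_diffs x1.
apply/eqP; rewrite -subr_eq0; apply/eqP.
pose f n := (1 - 2 * t * x + x ^+ 2) * pseries (pseries_diffs C) x n
    - 2 * nu * (t - x) * pseries C x n.
have cv : f @ \oo -->
    (1 - 2 * t * x + x ^+ 2) * limn (pseries (pseries_diffs C) x) -
    2 * nu * (t - x) * limn (pseries C x).
  by apply: cvgB; apply: cvgM => //; exact: cvg_cst.
suff : f @ \oo --> (0 : R) by exact: norm_cvg_unique cv.
have -> : f = (fun n => x ^+ n * (2 * nu * t * C n - n.+1%:R * C n.+1)
    + x ^+ n.+1 * (n%:R * C n)).
  by apply/funext => n; exact: gegen_ode_partial.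
(* The boundary terms are combinations of terms of convergent series, hence tend to 0; the shift by
   one lets [pseries_diffs] express the factors $n\,C_n$. *)
have t0 := cvg_series_cvg_0 c0; have t1 := cvg_series_cvg_0 c1.
rewrite -cvg_shiftS.
have -> : [sequence x ^+ n.+1 * (2 * nu * t * C n.+1 - n.+2%:R * C n.+2)
    + x ^+ n.+2 * (n.+1%:R * C n.+1)]_n =
  (fun n => 2 * nu * t * (C n.+1 * x ^+ n.+1) - pseries_diffs C n.+1 * x ^+ n.+1
    + x ^+ 2 * (pseries_diffs C n * x ^+ n)).
  by apply/funext => n /=; rewrite /pseries_diffs !exprS; ring.
move: (t0) (t1); rewrite -[X in X -> _]cvg_shiftS -[X in _ -> X -> _]cvg_shiftS => t0' t1'.
have := cvgD (cvgB (cvgM (cvg_cst (2 * nu * t)) t0') t1') (cvgM (cvg_cst (x ^+ 2)) t1).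
by rewrite !mulr0 subr0 addr0; apply.
Qed.

End Generating.
End Point.
End GegenbauerPolynomials.

(** * Closed forms of the Gegenbauer generating function and of its derivative *)

Section GegenbauerGenerating.
Context {R : realType} (nu t : R).
Hypotheses (nu_gt0 : 0 < nu) (t_le1 : `|t| <= 1).
Local Notation C := (fun n => (gegen nu n).[t]).
Local Notation q := (fun x : R => 1 - 2 * t * x + x ^+ 2).

Lemma is_derive_quad (x : R) : is_derive x (1 : R) q (2 * x - 2 * t).
Proof.
have -> : q = (cst 1 - (2 * t) *: (id : R -> R)) + (id : R -> R) ^+ 2.
  by apply/funext => y; rewrite !fctE.
have d := is_deriveD (is_deriveB (is_derive_cst (1 : R) x (1 : R))
  (is_deriveZ (2 * t) (is_derive_id x (1 : R)))) (is_deriveX 2 (is_derive_id x (1 : R))).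
apply: DeriveDef; [by case: d|case: d => _ ->].
rewrite /GRing.scale /= expr1 !mulr1 sub0r; ring.
Qed.

Let f (x : R) : R := limn (pseries C x) * q x `^ nu.

(** The derivative of $Gq^\nu$ is $q^{\nu-1}(qG'-2\nu(t-x)G)$, which the differential equation
    annihilates. *)
Lemma is_derive_gegen_powR x : `|x| < 1 -> is_derive x (1 : R) f 0.
Proof.
move=> x1; have q0 := gegen_quad_gt0 t_le1 x1.
have d1 := is_derive_pseries_gegen nu_gt0 t_le1 x1.
have d2 := is_derive1_comp (f := fun y : R => y `^ nu) (g := q)
  (is_derive1_powR nu q0) (is_derive_quad x).
have d3 := is_deriveM d1 d2.
have -> : f = (fun y => limn (pseries C y)) * ((fun y : R => y `^ nu) \o q) by [].
apply: DeriveDef; [by case: d3|case: d3 => _ ->; rewrite /GRing.scale].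
move: (gegen_ode nu_gt0 t_le1 x1) => {d1 d2}.
move: (limn (pseries (pseries_diffs C) x)) (limn (pseries C x)) => G' G h.
change (G * (nu * (q x) `^ (nu - 1) * (2 * x - 2 * t)) + (q x) `^ nu * G' = 0).
have qE : q x `^ nu = q x * q x `^ (nu - 1).
  rewrite -[X in _ = X * _](powRr1 (ltW q0)) -powRD; last by rewrite (gt_eqF q0) implybT.
  by congr (_ `^ _); ring.
rewrite qE [_ * G']mulrAC h /=; ring.
Qed.

(** By the mean value theorem $Gq^\nu$ is constant between 0 and $h$, and its value at 0 is 1. *)
Lemma gegen_generating h : `|h| < 1 -> limn (pseries C h) = q h `^ (- nu).
Proof.
move=> h1; have q0 := gegen_quad_gt0 t_le1 h1.
have f_cst (a b : R) : -1 < a -> a <= b -> b < 1 -> f a = f b.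
  move=> a1 ab b1; apply/eqP; rewrite eq_sym -subr_eq0; apply/eqP.
  have dI x : x \in `[a, b] -> is_derive x (1 : R) f 0.
    rewrite in_itv /= => /andP[ax xb]; apply: is_derive_gegen_powR.
    by rewrite ltr_norml; lra.
  have dI' x : x \in `]a, b[ -> is_derive x (1 : R) f (cst 0 x).
    by move=> xab; apply: dI; exact: subset_itv_oo_cc.
  have fc : {within `[a, b], continuous f}.
    by apply: derivable_within_continuous => x /dI[].
  by have [c _ ->] := MVT_segment ab dI' fc; rewrite /= mul0r.
have f0 : f 0 = 1.
  rewrite /f mulr0 subr0 expr0n addr0 powR1 mulr1.
  have -> : pseries C 0 = fun n => (0 < n)%:R.
    apply/funext => -[|n]; first by rewrite /pseries /series /= big_nil.
    rewrite /pseries /series /= big_nat_recl //= gegen0 expr0 mulr1.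
    by rewrite big1 ?addr0 // => i _; rewrite expr0n mulr0.
  apply: cvg_lim => //; rewrite -cvg_shiftS; exact: cvg_cst.
have fh : f h = 1.
  rewrite -f0; move: h1; rewrite ltr_norml => /andP[h1 h2].
  by have [h0|/ltW h0] := leP 0 h; [apply/esym|]; apply: f_cst => //; lra.
rewrite powRN; apply: (@mulIf _ (q h `^ nu)); first by rewrite gt_eqF // powR_gt0.
by rewrite mulVf ?gt_eqF ?powR_gt0.
Qed.

Lemma cvg_gegen h : `|h| < 1 -> series (fun n => C n * h ^+ n) @ \oo --> q h `^ (- nu).
Proof.
by move=> h1; rewrite -gegen_generating //; exact: (is_cvg_pseries_gegen nu_gt0 t_le1).
Qed.

(** The sum is $hG'(h)$, with $G'$ read off from the differential equation. It accounts for the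
    factor $n$ in the coefficient $1+n/(2\nu)$ of $X^{(n)}$. *)
Lemma cvg_gegen_diffs h : `|h| < 1 -> series (fun n => n%:R * C n * h ^+ n) @ \oo -->
  2 * nu * (t - h) * h * q h `^ (- nu - 1).
Proof.
move=> h1; have q0 := gegen_quad_gt0 t_le1 h1.
have -> : 2 * nu * (t - h) * h * q h `^ (- nu - 1) =
    h * limn (pseries (pseries_diffs C) h).
  rewrite powRB; last by apply/implyP => _; rewrite gt_eqF.
  rewrite powRr1 ?ltW // -gegen_generating //.
  apply: (@mulfI _ (q h)); first by rewrite gt_eqF.
  rewrite [RHS]mulrCA (gegen_ode nu_gt0 t_le1 h1) /=; field; rewrite gt_eqF //.
rewrite -cvg_shiftS.
have -> : [sequence series (fun n => n%:R * C n * h ^+ n) n.+1]_n =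
    (fun n => h * pseries (pseries_diffs C) h n).
  apply/funext => n; rewrite /pseries /series /= big_nat_recl // !mul0r add0r.
  rewrite mulr_sumr; apply: eq_bigr => i _; rewrite /pseries_diffs exprS; ring.
apply: cvgM; first exact: cvg_cst.
exact: (is_cvg_pseries_gegen_diffs nu_gt0 t_le1).
Qed.

End GegenbauerGenerating.

(** * Uniqueness of coefficients and identification of the chosen family *)

Section Uniqueness.
Context {R : realType}.

(** Once the lower coefficients vanish, $d_kh^k$ is minus the tail of a series with sum 0.
    Convergence at 1/2 bounds $|d_n|2^{-n}$ by [M], so for $0<h\le 1/4$ the tail is at most
    $2M(2h)^{k+1}$, of higher order than $h^k$. *)
Lemma pseries_eq0 (d : R^nat) :
  (forall h, `|h| < 1 -> series (fun n => d n * h ^+ n) @ \oo --> (0 : R)) ->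
  forall k, d k = 0.
Proof.
move=> hd; elim/ltn_ind => k IH.
have [M M0 hM] : exists2 M, 0 < M & forall n, `|d n * (1 / 2) ^+ n| <= M.
  have h2 : `|1 / 2| < 1 :> R by rewrite ger0_norm; lra.
  have /cvg_series_cvg_0 /cvgP /cvg_seq_bounded : cvgn (series (fun n => d n * (1 / 2) ^+ n)).
    by apply: cvgP; exact: hd.
  by move=> /pinfty_ex_gt0[M M0 hM]; exists M => // n; exact: hM.
apply/eqP; rewrite -normr_le0; apply/ler_addgt0Pl => e e0; rewrite addr0.
(* The bound 1/4 makes the tail geometric of ratio [2 * h <= 1 / 2]; the other one makes the
   resulting estimate $2^{k+2}Mh$ of $|d_k|$ at most [e]. *)
pose h := Num.min (1 / 4) (e / (M * 2 ^+ k.+2)).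
have M2 : 0 < M * 2 ^+ k.+2 by rewrite mulr_gt0 // exprn_gt0.
have h0 : 0 < h by rewrite lt_min divr_gt0 // divr_gt0.
have h4 : h <= 1 / 4 by rewrite ge_min lexx.
have h1 : `|h| < 1 by rewrite ger0_norm ?ltW //; lra.
have he : h * (M * 2 ^+ k.+2) <= e.
  by rewrite -ler_pdivlMr // ge_min lexx orbT.
suff : `|d k| * h ^+ k <= h ^+ k * (h * (M * 2 ^+ k.+2)).
  by rewrite mulrC ler_pM2l ?exprn_gt0 // => /le_trans; apply.
have cv : (fun n => `|series (fun n => d n * h ^+ n) n - d k * h ^+ k|) @ \oo -->
    `|0 - d k * h ^+ k|.
  by apply: cvg_norm; apply: cvgB; [exact: hd|exact: cvg_cst].
rewrite -[leLHS](_ : `|0 - d k * h ^+ k| = _); last first.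
  by rewrite sub0r normrN normrM normrX (ger0_norm (ltW h0)).
apply: (cvgr_to_le cv); exists k.+1 => // n /= kn.
rewrite /series /= (big_cat_nat (n := k.+1)) //= big_nat_recr //= big1_seq; last first.
  by move=> i; rewrite mem_index_iota => /andP[_ /IH ->]; rewrite mul0r.
rewrite add0r addrAC subrr add0r -[X in \sum_(X <= _ < _) _]add0n big_addn.
apply: le_trans (ler_norm_sum _ _ _) _.
apply: (@le_trans _ _ (\sum_(0 <= i < n - k.+1) M * (2 * h) ^+ k.+1 * (1 / 2) ^+ i)).
  apply: ler_sum => i _.
  have -> : d (i + k.+1)%N * h ^+ (i + k.+1) =
      d (i + k.+1)%N * (1 / 2) ^+ (i + k.+1) * (2 * h) ^+ k.+1 * (2 * h) ^+ i.
    rewrite -[RHS]mulrA -exprD [(k.+1 + i)%N]addnC -[RHS]mulrA -exprMn.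
    by congr (_ * _ ^+ _); field.
  have h2 : 0 <= 2 * h by rewrite mulr_ge0 // ltW.
  rewrite normrM [X in _ * X]ger0_norm ?exprn_ge0 //.
  rewrite normrM [X in _ * X * _]ger0_norm ?exprn_ge0 //.
  apply: ler_pM; rewrite ?mulr_ge0 ?exprn_ge0 //; first by rewrite ler_wpM2r ?exprn_ge0.
  by rewrite lerXn2r ?nnegrE //; lra.
rewrite -mulr_sumr big_mkord.
apply: le_trans (ler_wpM2l _ (sum_geometric_le _ _ _)) _; [|lra|lra|].
  by rewrite mulr_ge0 ?exprn_ge0 ?ltW // mulr_gt0.
by rewrite exprMn !exprS le_eqVlt; apply/orP; left; apply/eqP; field.
Qed.

Lemma gegenbauerP (nu : R) : 0 < nu -> gegenbauer_family nu (gegenbauer nu).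
Proof.
move=> nu0; rewrite /gegenbauer.
apply: (@xgetPex _ _ [set C | gegenbauer_family nu C]).
by exists (gegen nu) => t h t1 h1; exact: cvg_gegen.
Qed.

(** At a fixed point [t] both families have the same generating function in $h$, so their values
    there agree. *)
Lemma gegenbauerE (nu t : R) n : 0 < nu -> `|t| <= 1 ->
  (gegenbauer nu n).[t] = (gegen nu n).[t].
Proof.
move=> nu0 t1; apply/eqP; rewrite -subr_eq0; apply/eqP.
apply: (pseries_eq0 (d := fun n => (gegenbauer nu n).[t] - (gegen nu n).[t])) => h h1.
have := cvgB (gegenbauerP nu0 t1 h1) (cvg_gegen nu0 t1 h1); rewrite subrr => cv.
suff -> : series (fun k => ((gegenbauer nu k).[t] - (gegen nu k).[t]) * h ^+ k) =
  (fun N => series (fun k => (gegenbauer nu k).[t] * h ^+ k) N -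
            series (fun k => (gegen nu k).[t] * h ^+ k) N) by exact: cv.
apply/funext => N; rewrite /series /= -sumrB; apply: eq_bigr => k _.
by rewrite mulrBl.
Qed.

Lemma gegenbauer_norm_le (nu t : R) n : 0 < nu -> `|t| <= 1 ->
  `|(gegenbauer nu n).[t]| <= rising_coef (2 * nu) n.
Proof. by move=> nu0 t1; rewrite gegenbauerE //; exact: gegen_norm_le. Qed.

(** For an integer parameter the coefficient is binomial. This is the case of interest, since
    $2\nu=m-2+2j$. *)
Lemma rising_coef_nat_le N n : (0 < N)%N -> rising_coef N%:R n <= 2 ^+ (N + n) :> R.
Proof.
case: N => // N _.
suff -> : rising_coef N.+1%:R n = 'C(N + n, n)%:R :> R.
  rewrite -natrX ler_nat addSn; apply: (@leq_trans (2 ^ (N + n))); last first.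
    by rewrite leq_exp2l.
  rewrite (expnDn 1 1) (bigD1 (Ordinal (leq_addl N n : n < (N + n).+1)%N)) //=.
  by rewrite !exp1n !muln1 leq_addr.
elim: n => [|n IH]; first by rewrite rising_coef0 bin0.
apply: (@mulfI _ n.+1%:R); first by rewrite pnatr_eq0.
rewrite rising_coefS IH -!natrM -natrD -natrM; congr _%:R.
by rewrite [(N + n.+1)%N]addnS -mul_bin_diag /= addnS [(n + N)%N]addnC.
Qed.

End Uniqueness.

(** * Embedding factors *)

Section Coordinates.
Context {R : realType}.

Lemma xcoordE m (x : 'rV[R]_m) (i : 'I_m) : xcoord x i.+1 = x 0 i.
Proof.
by rewrite /xcoord (big_pred1 i) // => j; rewrite /= eqSS.
Qed.

Lemma xcoord_trunc n r (x : 'rV[R]_n) j : (j <= r)%N -> (0 < j)%N ->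
  xcoord (trunc r x) j = xcoord x j.
Proof. by case: j => // j jr _; rewrite (xcoordE _ (Ordinal jr)) mxE. Qed.

Lemma trunc_id m (x : 'rV[R]_m) : trunc m x = x.
Proof. by apply/rowP => i; rewrite mxE xcoordE. Qed.

Lemma trunc_trunc n r s (x : 'rV[R]_n) : (r <= s)%N ->
  trunc r (trunc s x) = trunc r x.
Proof.
move=> rs; apply/rowP => i; rewrite !mxE xcoord_trunc //.
exact: leq_trans (ltn_ord i) rs.
Qed.

Lemma widen_lift n (i : 'I_n) : widen_ord (leqnSn n) i = lift ord_max i.
Proof. by apply: val_inj; exact: esym (lift_max i). Qed.

Lemma trunc_lift n (x : 'rV[R]_n.+1) (i : 'I_n) : trunc n x 0 i = x 0 (lift ord_max i).
Proof. by rewrite mxE -xcoordE lift_max. Qed.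

Lemma enorm_ge0 m (x : 'rV[R]_m) : 0 <= enorm x.
Proof. exact: sqrtr_ge0. Qed.

Lemma coord_le_enorm m (x : 'rV[R]_m) i : `|x 0 i| <= enorm x.
Proof.
rewrite -sqrtr_sqr ler_wsqrtr // (bigD1 i) //= lerDl sumr_ge0 // => j _.
exact: sqr_ge0.
Qed.

Lemma xcoord_le_enorm m (x : 'rV[R]_m) j : `|xcoord x j| <= enorm x.
Proof.
case: j => [|j].
  by rewrite /xcoord big_pred0 // normr0 enorm_ge0.
have [jm|mj] := ltnP j m.
  by rewrite (xcoordE x (Ordinal jm)) coord_le_enorm.
rewrite /xcoord big_pred0 ?normr0 ?enorm_ge0 // => i.
by rewrite eqSS; apply/negbTE; rewrite neq_ltn (leq_trans (ltn_ord i) mj).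
Qed.

Lemma enorm_trunc_le n (x : 'rV[R]_n.+1) : enorm (trunc n x) <= enorm x.
Proof.
rewrite ler_wsqrtr // [leRHS]big_ord_recr /=.
apply: (@le_trans _ _ (\sum_(i < n) x 0 (widen_ord (leqnSn n) i) ^+ 2)); last first.
  by rewrite lerDl sqr_ge0.
by apply: ler_sum => i _; rewrite trunc_lift widen_lift.
Qed.

Lemma cl_vec_trunc c n (x : 'rV[R]_n.+1) :
  cl_vec c x = cl_incl n.+1 (cl_vec c (trunc n x)) + xcoord x n.+1 *: cl_gen R c n.+1 n.+1.
Proof.
rewrite /cl_vec big_ord_recr /= (xcoordE x ord_max); congr (_ + _).
rewrite raddf_sum /=; apply: eq_bigr => i _; rewrite cl_inclZ cl_incl_gen //.
by rewrite trunc_lift widen_lift.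
Qed.

Lemma cl_norm_vec_le c m (x : 'rV[R]_m) : `|cl_vec c x| <= m%:R * enorm x.
Proof.
apply: le_trans (ler_norm_sum _ _ _) _.
have -> : m%:R * enorm x = \sum_(i < m) enorm x by rewrite sumr_const card_ord mulr_natl.
apply: ler_sum => i _.
rewrite normrZ -[leRHS]mulr1; apply: ler_pM => //; first exact: coord_le_enorm.
exact: cl_norm_gen.
Qed.

End Coordinates.

Lemma powR_subr1 (R : realType) (a b : R) : 0 < a -> a `^ b = a * a `^ (b - 1).
Proof.
move=> a0; rewrite powRB; last by rewrite (gt_eqF a0) implybT.
by rewrite (powRr1 (ltW a0)) mulrC divfK // (gt_eqF a0).
Qed.

Section Embedding.
Context {R : realType} (c : clifford_kind) (n : nat).
Local Notation m := n.+3.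
Implicit Types (x : 'rV[R]_m) (h : R) (j a : nat).

Let nu a : R := m%:R / 2 + a%:R - 1.

Let mE : m%:R = n%:R + 3 :> R. Proof. by rewrite -natrD addn3. Qed.

Let nu_gt0 a : 0 < nu a.
Proof. by rewrite /nu mE; have := ler0n R n; have := ler0n R a; lra. Qed.

Let nu2E a : 2 * nu a = (n.+1 + 2 * a)%:R.
Proof. by rewrite /nu natrD natrM mE -natr1; field. Qed.

Let tt x := xcoord x m / enorm x.

(** At [x = 0] the quotient is 0 by convention, so this bound and [tt_enorm] hold there too and the
    origin needs no separate treatment later. *)
Let tt_le1 x : `|tt x| <= 1.
Proof.
rewrite /tt normrM normfV (ger0_norm (enorm_ge0 x)).
have [->|x0] := eqVneq (enorm x) 0; first by rewrite invr0 mulr0.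
by rewrite ler_pdivrMr ?mul1r ?xcoord_le_enorm // lt_neqAle eq_sym x0 enorm_ge0.
Qed.

Let tt_enorm x : tt x * enorm x = xcoord x m.
Proof.
rewrite /tt; have [x0|x0] := eqVneq (enorm x) 0; last by rewrite divfK.
rewrite x0 mulr0; apply/esym/normr0_eq0/le_anti.
by rewrite normr_ge0 -x0 xcoord_le_enorm.
Qed.

Lemma Ffun_norm_le j a x : enorm x <= 1 -> `|Ffun j a x| <= 2 ^+ (n.+1 + 2 * a + j).
Proof.
move=> x1; rewrite /Ffun normrM normrX (ger0_norm (enorm_ge0 x)).
rewrite -[leRHS]mul1r; apply: ler_pM; rewrite ?exprn_ge0 ?enorm_ge0 //.
  by rewrite exprn_ile1 ?enorm_ge0.
apply: le_trans (gegenbauer_norm_le j (nu_gt0 a) (tt_le1 x)) _.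
by rewrite nu2E rising_coef_nat_le.
Qed.

Lemma Ffun_pred_norm_le j a x : enorm x <= 1 ->
  `|Ffun_pred j a x| <= 2 ^+ (n.+1 + 2 * a + j).
Proof.
case: j => [|j] x1 /=; first by rewrite normr0 exprn_ge0.
by apply: le_trans (Ffun_norm_le j a x1) _; rewrite ler_eXn2l ?ltr1n // addnS.
Qed.

Let ratio j a : R := (m%:R - 2 + j%:R + 2 * a%:R) / (m%:R - 2 + 2 * a%:R).

Let ratioE j a : ratio j a = 1 + j%:R / (2 * nu a).
Proof.
rewrite /ratio; have -> : m%:R - 2 + 2 * a%:R = 2 * nu a by rewrite /nu; field.
have -> : m%:R - 2 + j%:R + 2 * a%:R = 2 * nu a + j%:R by rewrite /nu; field.
by rewrite mulrDl divff // mulf_neq0 // gt_eqF.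
Qed.

Let ratio_norm_le j a : `|ratio j a| <= 2 ^+ j.
Proof.
rewrite ratioE nu2E ger0_norm; last by rewrite addr_ge0 // divr_ge0.
apply: (@le_trans _ _ (1 + j%:R)).
  by rewrite lerD2l ler_pdivrMr ?ltr0n // ler_peMr // ler1n.
by rewrite nat1r -natrX ler_nat; exact: ltn_expl.
Qed.

(** In [mon], [j + a] is the total degree of the multi-index up to the factor's index, so
    multiplication by this factor preserves geometric bounds. *)
Lemma Xfactor_norm_le j a x : enorm x <= 1 ->
  `|Xfactor c j a x| <= 2 ^+ (2 * n + 9) * 4 ^+ (j + a).
Proof.
move=> x1; apply: le_trans (ler_normD _ _) _; rewrite cl_norm_alg normrM.
have e4 k : 4 ^+ k = 2 ^+ (2 * k) :> R by rewrite exprM; congr (_ ^+ _); ring.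
have h1 : `|ratio j a| * `|Ffun j a x| <= 2 ^+ (2 * n + 8) * 4 ^+ (j + a).
  apply: le_trans (ler_pM _ _ (ratio_norm_le j a) (Ffun_norm_le j a x1)) _ => //.
  by rewrite e4 -!exprD ler_eXn2l ?ltr1n //; lia.
have h2 : `|Ffun_pred j a.+1 x *: (cl_incl m (cl_vec c (trunc m.-1 x)) * cl_gen R c m m)|
    <= 2 ^+ (2 * n + 8) * 4 ^+ (j + a).
  rewrite normrZ.
  have h3 : `|cl_incl m (cl_vec c (trunc m.-1 x)) * cl_gen R c m m| <= 2 ^+ n.+2.
    apply: le_trans (cl_normM _ _) _; rewrite -[leRHS]mulr1.
    apply: ler_pM => //; last exact: cl_norm_gen.
    apply: le_trans (cl_norm_incl _ _) _; apply: le_trans (cl_norm_vec_le _ _) _.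
    apply: (@le_trans _ _ (n.+2%:R * 1)).
      by rewrite ler_wpM2l //; exact: le_trans (enorm_trunc_le x) x1.
    by rewrite mulr1 -natrX ler_nat ltnW // ltn_expl.
  apply: le_trans (ler_pM _ _ (Ffun_pred_norm_le j a.+1 x1) h3) _ => //.
  by rewrite e4 -!exprD ler_eXn2l ?ltr1n //; lia.
apply: le_trans (lerD h1 h2) _.
have -> : 2 ^+ (2 * n + 9) = 2 * 2 ^+ (2 * n + 8) :> R by rewrite -exprS addnS.
by rewrite -mulrA mulr_natl mulr2n.
Qed.

Local Notation dd x h := (1 - 2 * xcoord x m * h + h ^+ 2 * enorm x ^+ 2).

Lemma denom_gt_quarter x h : enorm x <= 1 -> `|h| <= 1 / 8 -> 1 / 4 <= dd x h.
Proof.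
move=> x1 h8; have x0 := enorm_ge0 x.
have : `|xcoord x m * h| <= enorm x * `|h|.
  by rewrite normrM ler_wpM2r // xcoord_le_enorm.
rewrite ler_norml => /andP[_ h1].
have h2 : enorm x * `|h| <= 1 / 8 by have := normr_ge0 h; nra.
by have := sqr_ge0 (h * enorm x); rewrite exprMn; nra.
Qed.

(** With $t=x_m/|x|$ and $y=|x|h$ the quadratic $1-2ty+y^2$ becomes $d$. The scalar part sums to
    $(1-x_mh)d^{-\nu-1}$ and the part along $\underline{x}e_m$ to $hd^{-\nu-1}$, as the parameter of
    $F_{m,j+1}$ is $\nu+1$; together they carry the common power $d^{-m/2-a}$. *)
Lemma Xfactor_has_sum a x h : enorm x <= 1 -> `|h| <= 1 / 8 ->
  has_sum (fun j => h ^+ j *: Xfactor c j a x)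
    ((1 + cl_vec c x * h%:A * cl_gen R c m m) * (dd x h `^ (- (m%:R / 2) - a%:R))%:A).
Proof.
move=> x1 h8; have x0 := enorm_ge0 x; pose y := enorm x * h.
have y8 : `|y| <= 1 / 8.
  by rewrite normrM (ger0_norm x0); have := normr_ge0 h; nra.
have y1 : `|y| < 1 by lra.
have d0 : 0 < dd x h by have := denom_gt_quarter x1 h8; lra.
have qE : 1 - 2 * tt x * y + y ^+ 2 = dd x h.
  by rewrite /y -(tt_enorm x); ring.
have FE b j : h ^+ j * Ffun j b x = (gegen (nu b) j).[tt x] * y ^+ j.
  by rewrite /Ffun (gegenbauerE _ (nu_gt0 b) (tt_le1 x)) exprMn; ring.
have geom4 : bounded_sums (fun j : nat => (1 / 2) ^+ j : R).
  have h2_ge0 : 0 <= 1 / 2 :> R by lra.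
  have h2_lt1 : 1 / 2 < 1 :> R by lra.
  have phi_inj : injective (fun j : nat => [ffun=> j] : {ffun 'I_1 -> nat}).
    by move=> j j' /ffunP/(_ ord0); rewrite !ffunE.
  have := bounded_sums_inj phi_inj (bounded_sums_geometric 1 h2_ge0 h2_lt1).
  by apply: le_bounded_sums => j /=; rewrite /mdeg big_ord1 ffunE.
have FS b j : `|h ^+ j * Ffun j b x| <= 2 ^+ (n.+1 + 2 * b) * (1 / 4) ^+ j.
  have hj : `|h ^+ j| <= (1 / 8) ^+ j by rewrite normrX lerXn2r ?nnegrE //; lra.
  rewrite normrM mulrC; apply: le_trans (ler_pM _ _ (Ffun_norm_le j b x1) hj) _ => //.
  rewrite exprD -mulrA ler_wpM2l ?exprn_ge0 // -exprMn le_eqVlt; apply/orP; left.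
  by apply/eqP; congr (_ ^+ _); field.
have s1 : has_sum (fun j => h ^+ j * (ratio j a * Ffun j a x) : R^o)
    ((1 - xcoord x m * h) * dd x h `^ (- nu a - 1)).
  apply: series_has_sum.
    apply: (@le_summable _ _ _ _ (fun j => 2 ^+ (n.+1 + 2 * a) * (1 / 2) ^+ j)).
      move=> j; rewrite mulrCA normrM.
      apply: le_trans (ler_pM _ _ (ratio_norm_le j a) (FS a j)) _ => //.
      rewrite mulrCA ler_wpM2l ?exprn_ge0 // -exprMn le_eqVlt; apply/orP; left.
      by apply/eqP; congr (_ ^+ _); field.
    by apply: bounded_sumsZ; rewrite ?exprn_ge0.
  have := cvgD (cvg_gegen (nu_gt0 a) (tt_le1 x) y1)
    (cvgM (cvg_cst (2 * nu a)^-1) (cvg_gegen_diffs (nu_gt0 a) (tt_le1 x) y1)).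
  rewrite qE => cv.
  (* From $1-2ty+y^2+(t-y)y=1-ty$ and $ty=x_mh$. *)
  have -> : (1 - xcoord x m * h) * dd x h `^ (- nu a - 1) = dd x h `^ (- nu a) +
      (2 * nu a)^-1 * (2 * nu a * (tt x - y) * y * dd x h `^ (- nu a - 1)).
    have -> : dd x h `^ (- nu a) = dd x h * dd x h `^ (- nu a - 1).
      exact: powR_subr1.
    move: (dd x h `^ _) => P; rewrite -qE -tt_enorm /y; field.
    by rewrite gt_eqF.
  suff -> : series (fun j => h ^+ j * (ratio j a * Ffun j a x)) =
      (fun N => series (fun j => (gegen (nu a) j).[tt x] * y ^+ j) N +
        (2 * nu a)^-1 * series (fun j => j%:R * (gegen (nu a) j).[tt x] * y ^+ j) N).
    exact: cv.
  apply/funext => N; rewrite /series /= mulr_sumr -big_split; apply: eq_bigr => j _ /=.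
  by rewrite mulrCA FE ratioE; ring.
have s2 b : has_sum (fun j => h ^+ j * Ffun j b x : R^o) (dd x h `^ (- nu b)).
  apply: series_has_sum.
    apply: (le_summable (FS b)).
    apply: (@le_bounded_sums _ _ _ (fun j => 2 ^+ (n.+1 + 2 * b) * (1 / 2) ^+ j)).
      move=> j; rewrite ler_wpM2l ?exprn_ge0 // lerXn2r ?nnegrE //; lra.
    by apply: bounded_sumsZ; rewrite ?exprn_ge0.
  by rewrite -qE; under eq_fun do rewrite FE; exact: cvg_gegen.
have s3 : has_sum (fun j => h ^+ j * Ffun_pred j a.+1 x : R^o)
    (h * dd x h `^ (- nu a.+1)).
  apply: (has_sum_inj succn_inj) => [[|j] hj|]; first by rewrite /= mulr0.
    by have := hj j; rewrite eqxx.
  apply: eq_has_sum (has_sumZ (a := h) (s2 a.+1)) => j /=.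
  by rewrite exprS -mulrA.
set v := cl_incl m (cl_vec c (trunc m.-1 x)) * cl_gen R c m m.
have := has_sumD (has_sum_scale (v := 1 : clifford R c m) s1)
  (has_sum_scale (v := v : clifford R c m) s3).
have -> : (1 - xcoord x m * h) * dd x h `^ (- nu a - 1) *: 1 +
    (h * dd x h `^ (- nu a.+1)) *: v =
  (1 + cl_vec c x * h%:A * cl_gen R c m m) * (dd x h `^ (- (m%:R / 2) - a%:R))%:A.
  have -> : - nu a.+1 = - (m%:R / 2) - a%:R by rewrite /nu -natr1; ring.
  have -> : - nu a - 1 = - (m%:R / 2) - a%:R by rewrite /nu; ring.
  move: (dd x h `^ _) => P.
  have ee : cl_gen R c m m * cl_gen R c m m = -1 by exact: (cl_gen_sqr R c (ord_max : 'I_m)).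
  (* As $e_m^2=-1$, the last component of $x$ contributes the scalar $-x_mh$. *)
  have -> : cl_vec c x * h%:A * cl_gen R c m m = h *: v - (xcoord x m * h)%:A.
    rewrite -scalerAr mulr1 -scalerAl cl_vec_trunc mulrDl -scalerAl ee scalerN.
    by rewrite scalerBr scalerA [h * _]mulrC.
  rewrite -[RHS]scalerAr mulr1; move: (xcoord x m * h) => z.
  have -> : 1 + (h *: v - z%:A) = (1 - z) *: 1 + h *: v.
    by rewrite scalerBl scale1r [RHS]addrAC addrA.
  by rewrite [RHS]scalerDr !scalerA [P * (1 - z)]mulrC [P * h]mulrC.
by apply: eq_has_sum => j; rewrite /Xfactor -/v scalerDr !scalerA.
Qed.

End Embedding.

(** * Monogenic functions and their generating function *)

Section Splitting.
Context {n : nat}.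
Implicit Types (k : {ffun 'I_n.+1 -> nat}) (l : {ffun 'I_n -> nat}).

Definition mrestr k : {ffun 'I_n -> nat} := [ffun i => k (lift ord_max i)].

Definition mjoin (p : {ffun 'I_n -> nat} * nat) : {ffun 'I_n.+1 -> nat} :=
  [ffun i => if unlift ord_max i is Some i' then p.1 i' else p.2].

Lemma mjoin_bij : bijective mjoin.
Proof.
exists (fun k => (mrestr k, k ord_max)) => [[l j]|k].
  congr (_, _); last by rewrite ffunE unlift_none.
  by apply/ffunP => i; rewrite !ffunE liftK.
apply/ffunP => i; rewrite ffunE /=.
by case: unliftP => [i' ->|->//]; rewrite ffunE.
Qed.

Lemma mrestr_mjoin l j : mrestr (mjoin (l, j)) = l.
Proof. by apply/ffunP => i; rewrite !ffunE liftK. Qed.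

Lemma mjoin_max l j : mjoin (l, j) ord_max = j.
Proof. by rewrite ffunE unlift_none. Qed.

Lemma mdeg_restr k : mdeg k = (mdeg (mrestr k) + k ord_max)%N.
Proof.
rewrite /mdeg big_ord_recr /=; congr (_ + _)%N; apply: eq_bigr => i _.
by rewrite ffunE widen_lift.
Qed.

Lemma hpow_restr (R : realType) (h : 'rV[R]_n.+1) k :
  hpow h k = hpow (trunc n h) (mrestr k) * h 0 ord_max ^+ k ord_max.
Proof.
rewrite /hpow big_ord_recr /=; congr (_ * _); apply: eq_bigr => i _.
by rewrite ffunE widen_lift trunc_lift.
Qed.

End Splitting.

Section Monogenic.
Context {R : realType} {c : clifford_kind}.

Lemma kcoord_max n (k : {ffun 'I_n.+1 -> nat}) : kcoord (m := n.+2) k n.+2 = k ord_max.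
Proof.
by rewrite /kcoord (big_pred1 ord_max).
Qed.

Lemma kcoord_restr n (k : {ffun 'I_n.+1 -> nat}) r : (r <= n.+1)%N ->
  kcoord (m := n.+2) k r = kcoord (m := n.+1) (mrestr k) r.
Proof.
move=> rn; rewrite /kcoord big_mkcond big_ord_recr /= gtn_eqF ?ltnS // addn0.
by rewrite [RHS]big_mkcond; apply: eq_bigr => i _; rewrite ffunE widen_lift.
Qed.

Lemma kstar_restr n (k : {ffun 'I_n.+1 -> nat}) r : (r <= n.+1)%N ->
  kstar (m := n.+2) k r = kstar (m := n.+1) (mrestr k) r.
Proof.
move=> rn; rewrite /kstar big_mkcond big_ord_recr /= leqNgt ltnS rn addn0.
by rewrite [RHS]big_mkcond; apply: eq_bigr => i _; rewrite ffunE widen_lift.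
Qed.

Lemma kstar_mdeg n (k : {ffun 'I_n -> nat}) : kstar (m := n.+1) k n.+1 = mdeg k.
Proof.
by rewrite /kstar /mdeg big_mkcond /=; apply: eq_bigr => i _; rewrite !ltnS ltn_ord.
Qed.

Lemma cl_incl_prod n m (T : Type) (r : seq T) (F : T -> clifford R c n) : (n <= m)%N ->
  cl_incl m (\prod_(i <- r) F i) = \prod_(i <- r) cl_incl m (F i).
Proof.
move=> nm; elim: r => [|i r IH]; first by rewrite !big_nil cl_incl1.
by rewrite !big_cons cl_inclM // IH.
Qed.

Lemma cl_incl_mon2 n m j (x1 x2 : R) : (2 <= n)%N -> (n <= m)%N ->
  cl_incl m (mon2 c n j x1 x2) = mon2 c m j x1 x2.
Proof.
move=> n2 nm; rewrite /mon2 cl_inclZ cl_inclX //; congr (_ *: _ ^+ _).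
have n1 : (0 < n)%N by apply: leq_trans n2.
rewrite raddfB /= cl_inclZ cl_incl1 //; congr (_ - _).
rewrite !cl_inclM // (cl_incl_gen R c (Ordinal n1)) // (cl_incl_gen R c (Ordinal n2)) //.
by rewrite cl_inclZ cl_incl1.
Qed.

(** The factor of largest index stands leftmost; the remaining ones involve only the first $m-1$
    coordinates and already live in the smaller algebra. *)
Lemma monS n (k : {ffun 'I_n.+2 -> nat}) (x : 'rV[R]_n.+3) :
  mon c (m := n.+3) k x = Xfactor c (k ord_max) (mdeg (mrestr k)) x *
    cl_incl n.+3 (mon c (m := n.+2) (mrestr k) (trunc n.+2 x)).
Proof.
rewrite /mon !subSS !subn0.
have -> : rev (iota 3 n.+1) = n.+3 :: rev (iota 3 n).
  by rewrite -[X in iota 3 X]addn1 iotaD rev_cat /= add3n.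
rewrite big_cons -mulrA; congr (_ * _).
  apply: etrans (cl_incl_id _) _.
  by rewrite (trunc_id x) kcoord_max (kstar_restr _ (leqnn _)) kstar_mdeg.
rewrite (cl_inclM _ _ (leqnSn n.+2)); congr (_ * _).
  rewrite (cl_incl_prod _ _ (leqnSn n.+2)) !big_seq; apply: eq_bigr => r.
  rewrite mem_rev mem_iota add3n ltnS => /andP[r3 rn].
  rewrite (cl_incl_incl _ rn (leqnSn n.+2)); congr (cl_incl _ (Xfactor c _ _ _)).
  - exact: kcoord_restr.
  - by apply: kstar_restr; exact: leq_trans (leq_pred _) rn.
  - by rewrite trunc_trunc.
rewrite (cl_incl_mon2 _ _ _ _ (leqnSn n.+2)) // (kcoord_restr (n := n.+1)) //.
by rewrite (xcoord_trunc (r := n.+2)) // (xcoord_trunc (r := n.+2)).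
Qed.

Lemma mon_geom_bounded n : exists M C : R, 0 < C /\
  forall x : 'rV[R]_n.+2, enorm x <= 1 -> geom_bounded ((mon c (m := n.+2))^~ x) M C.
Proof.
elim: n => [|n [M [C [C0 IH]]]].
  (* In the unit ball $|x_1-e_{12}x_2|\le |x_1|+|x_2|\le 2$. *)
  exists 1, 2; split => // x x1 k; rewrite mul1r /mon /= big_nil mul1r.
  rewrite /mon2 normrZ ger0_norm ?invr_ge0 //.
  have -> : mdeg k = kcoord (m := 2) k 2.
    by rewrite (kcoord_max (n := 0)) /mdeg big_ord1; congr (k _); exact: val_inj.
  move: (kcoord _ _) => j; rewrite -[leRHS]mul1r; apply: ler_pM => //.
    by rewrite invf_le1 ?ltr0n ?fact_gt0 // ler1n fact_gt0.
  apply: le_trans (cl_normX _ _) _; rewrite lerXn2r ?nnegrE //.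
  apply: le_trans (ler_normB _ _) _; rewrite cl_norm_alg.
  have -> : 2 = 1 + 1 * 1 :> R by ring.
  apply: lerD; first by apply: le_trans x1; exact: xcoord_le_enorm.
  apply: le_trans (cl_normM _ _) _; rewrite cl_norm_alg.
  apply: ler_pM => //; last by apply: le_trans x1; exact: xcoord_le_enorm.
  apply: le_trans (cl_normM _ _) _; rewrite -[leRHS]mulr1.
  by apply: ler_pM => //; exact: cl_norm_gen.
(* The 4 comes from the new factor; [1 + C] replaces [C] so that its powers increase with the
   exponent, from [mdeg (mrestr k)] to [mdeg k]. *)
exists (2 ^+ (2 * n + 9) * M), (4 * (1 + C)); split.
  by rewrite mulr_gt0 // addr_gt0.
move=> x x1 k; rewrite monS.
have M0 : 0 <= M.
  have e1 : enorm (0 : 'rV[R]_n.+2) <= 1.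
    by rewrite /enorm big1 ?sqrtr0 // => i _; rewrite mxE expr0n.
  exact: geom_bounded_ge0 (IH 0 e1).
apply: le_trans (cl_normM _ _) _.
have h2 : `|cl_incl n.+3 (mon c (m := n.+2) (mrestr k) (trunc n.+2 x))| <=
    M * (1 + C) ^+ mdeg k.
  apply: le_trans (cl_norm_incl _ _) _.
  apply: le_trans (IH _ (le_trans (enorm_trunc_le x) x1) _) _.
  rewrite ler_wpM2l //.
  apply: (@le_trans _ _ ((1 + C) ^+ mdeg (mrestr k))).
    by rewrite lerXn2r ?nnegrE ?addr_ge0 ?lerDr // ltW.
  by apply: ler_weXn2l; [rewrite lerDl ltW|rewrite (mdeg_restr k) leq_addr].
apply: le_trans (ler_pM _ _ (Xfactor_norm_le c (k ord_max) (mdeg (mrestr k)) x1) h2) _ => //.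
rewrite [(k ord_max + _)%N]addnC -(mdeg_restr k) exprMn le_eqVlt; apply/orP; left.
by apply/eqP; ring.
Qed.

Lemma has_sum_mull m (I : choiceType) (f : I -> clifford R c m) (s a : clifford R c m) :
  has_sum f s -> has_sum (fun i => a * f i) (a * s).
Proof.
apply: (has_sum_additive (L := fun v => a * v) (K := `|a|)) => [u v|v]; first exact: mulrDr.
exact: cl_normM.
Qed.

Lemma has_sum_mulr m (I : choiceType) (f : I -> clifford R c m) (s a : clifford R c m) :
  has_sum f s -> has_sum (fun i => f i * a) (s * a).
Proof.
apply: (has_sum_additive (L := fun v : clifford R c m => v * a) (K := `|a|)) => [u v|v].
  exact: mulrDl.
apply: le_trans (cl_normM _ _) _; by rewrite [leRHS]mulrC.
Qed.

Lemma has_sum_incl n m (I : choiceType) (f : I -> clifford R c n) (s : clifford R c n) :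
  has_sum f s -> has_sum (fun i => cl_incl m (f i)) (cl_incl m s).
Proof.
apply: (has_sum_additive (L := @cl_incl R c n m) (K := 1)) => [u v|v]; first exact: cl_inclD.
by rewrite mul1r; exact: cl_norm_incl.
Qed.

End Monogenic.

(** * Recursion and Taylor coefficients of the generating function *)

Section GeneratingFunction.
Context {R : realType} {c : clifford_kind}.

(** The family over pairs and the family of row sums both have known unconditional sums; Fubini
    makes the first a sum of the rows, and uniqueness identifies it with the second. *)
Lemma genfun_rec n (x : 'rV[R]_n.+3) (h : 'rV[R]_n.+2) :
  let hm := h 0 ord_max in
  let d := 1 - 2 * xcoord x n.+3 * hm + hm ^+ 2 * enorm x ^+ 2 in
  let x' := trunc n.+2 x in let h' := d^-1 *: trunc n.+1 h in
  enorm x <= 1 -> `|hm| <= 1 / 8 ->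
  genfun_defined c (m := n.+3) x h -> genfun_defined c (m := n.+2) x' h' ->
  genfun c (m := n.+3) x h =
    (1 + cl_vec c x * hm%:A * cl_gen R c n.+3 n.+3) * (d `^ (- (n.+3%:R / 2)))%:A
    * cl_incl n.+3 (genfun c (m := n.+2) x' h').
Proof.
move=> hm d x' h' x1 h8 sum_h sum_h'.
have d0 : 0 < d by have := denom_gt_quarter x1 h8; rewrite -/d; lra.
set A := 1 + _; set B := (d `^ _)%:A.
pose f := genfun_term c (m := n.+3) x h; pose f' := genfun_term c (m := n.+2) x' h'.
have sf : has_sum (f \o mjoin) (genfun c (m := n.+3) x h).
  by apply: has_sum_bij; [exact: mjoin_bij|exact: summable_has_sum].
pose g l := A * B * cl_incl n.+3 (f' l).
have sg : has_sum g (A * B * cl_incl n.+3 (genfun c (m := n.+2) x' h')).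
  by apply: has_sum_mull; apply: has_sum_incl; exact: summable_has_sum.
apply: (has_sum_unique _ sg); apply: (has_sum_fubini sf) => l.
have := has_sumZ (a := hpow (trunc n.+1 h) l)
  (has_sum_mulr (a := cl_incl n.+3 (mon c (m := n.+2) l x'))
    (Xfactor_has_sum (c := c) (a := mdeg l) x1 h8)).
rewrite -/hm -/d -/A.
have -> : hpow (trunc n.+1 h) l *: (A * (d `^ (- (n.+3%:R / 2) - (mdeg l)%:R))%:A *
    cl_incl n.+3 (mon c (m := n.+2) l x')) = g l.
  rewrite /g /f' /genfun_term hpowZ cl_inclZ /B powRB; last by rewrite (gt_eqF d0) implybT.
  rewrite powR_mulrn ?ltW // exprVn.
  rewrite -!scalerAr !mulr1 -!scalerAl !scalerA; congr (_ *: _).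
  ring.
apply: eq_has_sum => j.
transitivity (hpow h (mjoin (l, j)) *: mon c (m := n.+3) (mjoin (l, j)) x); last by [].
by rewrite (hpow_restr h (mjoin (l, j))) monS mjoin_max mrestr_mjoin -scalerAl scalerA.
Qed.

(** By unfolding, [genfun c x] is [pser] with coefficients [mon]. *)
Lemma partials_genfun m (k : {ffun 'I_m.-1 -> nat}) (x : 'rV[R]_m) (M C : R) :
  0 < C -> geom_bounded ((mon c (m := m))^~ x) M C ->
  partials_exist (directions k) (genfun c x) 0 /\
  mon c k x = ((mfact k)%:R)^-1 *: partials (directions k) (genfun c x) 0.
Proof.
move=> C0 xMC; have [h1 /nbhs_singleton h2] := partials_pser (directions k) C0 xMC.
split; first exact: h1.
have -> : partials (directions k) (genfun c x) 0 =
    pser (foldr (@dcoef _ _ _) ((mon c (m := m))^~ x) (directions k)) 0 by exact: h2.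
rewrite pser0; have := mfact_dcoef ((mon c (m := m))^~ x) (directions k) [ffun=> 0%N].
have -> : [ffun i => ([ffun=> 0%N] i + count_mem i (directions k))%N] = k.
  by apply/ffunP => i; rewrite !ffunE add0n count_directions.
rewrite {1}/mfact big1 => [|i _]; last by rewrite ffunE.
rewrite scale1r => ->; rewrite scalerA mulVf ?scale1r // pnatr_eq0 -lt0n.
by rewrite prodn_gt0 // => i; exact: fact_gt0.
Qed.

Lemma genfun_defined_coord n (x : 'rV[R]_n.+2) (h : 'rV[R]_n.+1) (M C rho : R) :
  geom_bounded ((mon c (m := n.+2))^~ x) M C -> 0 < C -> 0 <= rho -> rho * C < 1 ->
  (forall i, `|h 0 i| <= rho) -> genfun_defined c (m := n.+2) x h.
Proof.
by move=> xMC C0 rho0 rhoC h_rho; exact: (geom_bounded_summable (ltW C0) xMC h_rho).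
Qed.

End GeneratingFunction.

Theorem theorem2 (R : realType) (c : clifford_kind) (m : nat) :
  (2 <= m)%N ->
  exists U : set 'rV[R]_m.-1, nbhs (0 : 'rV[R]_m.-1) U /\
  [/\ (forall (x : 'rV[R]_m) (h : 'rV[R]_m.-1),
         enorm x <= 1 -> U h -> genfun_defined c x h),
      (forall (k : {ffun 'I_m.-1 -> nat}) (x : 'rV[R]_m),
         enorm x <= 1 ->
         partials_exist (directions k) (genfun c x) 0 /\
         mon c k x =
           ((mfact k)%:R)^-1 *: partials (directions k) (genfun c x) 0)
    & ((3 <= m)%N ->
       forall (x : 'rV[R]_m) (h : 'rV[R]_m.-1),
         enorm x <= 1 -> U h ->
         let hm := hcoord h m in
         let d := 1 - 2 * xcoord x m * hm + hm ^+ 2 * enorm x ^+ 2 in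
         let x' : 'rV[R]_m.-1 := trunc m.-1 x in
         let h' : 'rV[R]_m.-1.-1 := d^-1 *: trunc m.-1.-1 h in
         [/\ 0 < d,
             genfun_defined c x' h' &
             genfun c x h =
               (1 + cl_vec c x * hm%:A * cl_gen R c m m)
               * (d `^ (- (m%:R / 2)))%:A
               * cl_incl m (genfun c x' h')])].
Proof.
case: m => [|[|n]] // _.
have [M [C [C0 monMC]]] := mon_geom_bounded (R := R) (c := c) n.
have [M' [C' [C'0 monMC']]] := mon_geom_bounded (R := R) (c := c) n.-1.
(* The radius meets three demands: [r <= 1 / 8] for the lower bound on [d], [r * C < 1] for
   convergence at [h], and [4 * r * C' < 1] for convergence at [h / d], whose coordinates are at
   most [4 * r]. *)
pose r := (8 * (1 + C + C'))^-1.
have D0 : 0 < 8 * (1 + C + C') by lra.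
have r0 : 0 < r by rewrite invr_gt0.
have rD : r * (8 * (1 + C + C')) = 1 by rewrite mulVf // gt_eqF.
have r8 : r <= 1 / 8 by nra.
have rC : r * C < 1 by nra.
have rC' : 4 * r * C' < 1 by nra.
exists [set h | forall i, `|(h : 'rV[R]_n.+1) 0 i| < r]; split.
  by apply: coord_lt_near => // i; rewrite mxE normr0.
split=> [x h x1 hU|k x x1|n3 x h x1 hU].
- apply: (genfun_defined_coord (monMC x x1) C0 (ltW r0) rC) => i; exact: ltW.
- exact: partials_genfun C0 (monMC x x1).
clearbody r; destruct n as [|n]; first by [].
rewrite /=.
have -> : hcoord (m := n.+3) h n.+3 = h 0 ord_max.
  by rewrite /hcoord (big_pred1 ord_max).
have h8 : `|h 0 ord_max| <= 1 / 8 by apply: le_trans r8; exact: ltW.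
set d := 1 - _ + _; have d4 : 1 / 4 <= d by exact: denom_gt_quarter.
have d0 : 0 < d by lra.
have x'1 : enorm (trunc n.+2 x) <= 1 by exact: le_trans (enorm_trunc_le x) x1.
have def' : genfun_defined c (m := n.+2) (trunc n.+2 x) (d^-1 *: trunc n.+1 h).
  apply: (genfun_defined_coord (monMC' _ x'1) C'0 (rho := 4 * r)) => // [|i].
    by rewrite mulr_ge0 // ltW.
  rewrite mxE trunc_lift normrM; apply: ler_pM => //; last exact: ltW.
  by rewrite normfV (ger0_norm (ltW d0)) invf_ple ?posrE //; lra.
split=> //; apply: genfun_rec => //.
by apply: (genfun_defined_coord (monMC x x1) C0 (ltW r0) rC) => i; exact: ltW.
Qed.
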